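(* Let $\mathcal H,\mathcal G$, $L$, $A$, $B$, $C$, $D$, $\beta$, $\vartheta$, $\mathbf Z$ be as in the Problem described in the context and let the Assumption (i)–(v) of the context hold, with constants $\mu_A,\mu_B,\rho_A,\rho_B,\nu_A,\nu_B$ and sets $\Omega_A,\Omega_B$. Let $(\tau,\sigma)\in\Omega_A\times\Omega_B$ be such that $\kappa=1-\sigma\tau\|L\|^2>0$, let $\theta\in\,]0,2[$, let $(z_{-1},z_0,p_0,v_0)\in\mathcal H^3\times\mathcal G$, set $y_{-1}=Dz_{-1}$, and iterate $$(\forall n\in\mathbb N)\quad\left\lfloor\begin{aligned}&y_n=Dz_n\\&x_n=z_n-\tau(y_n-y_{n-1}+Dp_n+Cz_n+L^*v_n)\\&p_{n+1}=J_{\tau A}x_n\\&w_n=v_n+\sigma L(2p_{n+1}-z_n)\\&q_{n+1}=J_{\sigma B^{-1}}w_n\\&(z_{n+1},v_{n+1})=(1-\theta)(z_n,v_n)+\theta(p_{n+1},q_{n+1}).\end{aligned}\right.$$ Let $\hat\rho\le0$ be the constant defined in the context, let $\overline\chi=1+\sqrt{\sigma\tau}\,\|L\|$, and let $\eta_\theta=1$ if $\theta\in[1,2[$ and $D$ is monotone, $\eta_\theta=1+|1-\theta|$ otherwise. Suppose that $\beta\kappa+\overline\chi\hat\rho(1+\vartheta/\kappa)>0$ and $$\tau\Big(2-\theta-2\tau\frac{\eta_\theta\vartheta}{\kappa}\Big)>\frac{(\tau+2\overline\chi\hat\rho)^2}{2\big(\beta\kappa+\overline\chi\hat\rho(1+\vartheta/\kappa)\big)}-2\overline\chi\hat\rho\left(\Big(2\tau\frac{\vartheta}{\kappa}+1\Big)^2+4\tau^2\frac{\vartheta}{\kappa}\right).$$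 Then: (i) the sequence $(z_n,v_n)_{n\in\mathbb N}$ converges weakly to a point of $\mathbf Z$; (ii) if $\nu_A>0$ and $\nu_B>0$, then $(z_n,v_n)_{n\in\mathbb N}$ converges R-linearly to the unique point of $\mathbf Z$.
   Context: Problem. $\mathcal H,\mathcal G$ are real Hilbert spaces, $L:\mathcal H\to\mathcal G$ is bounded linear with adjoint $L^*$, $A:\mathcal H\to2^{\mathcal H}$ and $B:\mathcal G\to2^{\mathcal G}$ are set-valued, $C:\mathcal H\to\mathcal H$ is $\beta$-cocoercive ($\langle x-y,Cx-Cy\rangle\ge\beta\|Cx-Cy\|^2$) with $\beta>0$, $D:\mathcal H\to\mathcal H$ is $\vartheta$-Lipschitzian with $\vartheta\ge0$. The solution set $\mathbf Z$ is the set of $(x,u)\in\mathcal H\times\mathcal G$ with $0\in(A+C+D)x+L^*u$ and $u\in BLx$; it is assumed nonempty. Semimonotonicity. For bounded self-adjoint linear $M,N$ and a set $\mathcal S$ of pairs, a set-valued operator $E$ is $(M,N)$-semimonotone on $\mathcal S$ if $\langle x-y,u-v\rangle\ge\langle x-y,M(x-y)\rangle+\langle u-v,N(u-v)\rangle$ for all $(y,v)\in\mathcal S$ and $(x,u)\in\operatorname{gra}E$. A scalar in place of $M$ or $N$ denotes that multiple of the identity. $J_E=(\mathrm{Id}+E)^{-1}$. On $\mathbf H=\mathcal H\times\mathcal G$ define $\mathbf A(z,v)=\big((A+D)z+L^*v\big)\times\big(B^{-1}v-Lz\big)$ and $\mathbf C(z,v)=(Cz,0)$ (so $\operatorname{zer}(\mathbf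 A+\mathbf C)=\mathbf Z$). Assumption. $(\mu_A,\mu_B,\rho_A,\rho_B)\in\mathbb R^4$, $(\nu_A,\nu_B)\in[0,+\infty[^2$, and (i) $\rho_A+\rho_B\ge0$, $\mu_A+\mu_B\ge0$, ($\rho_A+\rho_B=0\Rightarrow\rho_A=\rho_B=0$), ($\mu_A+\mu_B=0\Rightarrow\mu_A=\mu_B=0$); (ii) $A+D$ is $(\nu_A\mathrm{Id}+\mu_AL^*L,\rho_A)$-semimonotone on $\{(x^*,-Cx^*-L^*u^* ):(x^*,u^* )\in\mathbf Z\}$; (iii) $B$ is $(\mu_B,\nu_B\mathrm{Id}+\rho_BLL^* )$-semimonotone on $\{(Lx^*,u^* ):(x^*,u^* )\in\mathbf Z\}$; (iv) $\Omega_A,\Omega_B\subset\,]0,+\infty[$ are nonempty sets such that, for every $(\tau,\sigma)\in\Omega_A\times\Omega_B$, $J_{\tau A}$ and $J_{\sigma B^{-1}}$ are single-valued with full domain; (v) $\operatorname{gra}(\mathbf A+\mathbf C)$ is sequentially weak-strong closed ($x_n\rightharpoonup x$, $u_n\to u$, $(x_n,u_n)$ in the graph imply $(x,u)$ in the graph). Definition of $\hat\rho$. With $\rho_{A,B}=\rho_A\rho_B/(\rho_A+\rho_B)$ if $\rho_A+\rho_B>0$ and $\mu_{A,B}=\mu_A\mu_B/(\mu_A+\mu_B)$ if $\mu_A+\mu_B>0$: $\hat\rho=\min\{0,\rho_{A,B},\frac{\tau}{\sigma}\mu_{A,B}\}$ if $\min\{\rho_A+\rho_B,\mu_A+\mu_B\}>0$;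 $\hat\rho=\min\{0,\frac\tau\sigma\mu_{A,B}\}$ if $\rho_A=\rho_B=0$ and $\mu_A+\mu_B>0$; $\hat\rho=\min\{0,\rho_{A,B}\}$ if $\mu_A=\mu_B=0$ and $\rho_A+\rho_B>0$; $\hat\rho=0$ if $\mu_A=\mu_B=\rho_A=\rho_B=0$. R-linear convergence of $(x_n)$ to $x$: $\|x_n-x\|\le c\,r^n$ for some $c\ge0$, $r\in\,]0,1[$. *)

(* Defs.v *)
From HB Require Import structures.
From mathcomp Require Import all_boot all_order all_algebra.
From mathcomp Require Import all_classical all_reals all_analysis.
Set Implicit Arguments.
Unset Strict Implicit.
Unset Printing Implicit Defensive.
Import Order.TTheory GRing.Theory Num.Theory.
Import numFieldNormedType.Exports.
Local Open Scope classical_set_scope.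
Local Open Scope ring_scope.

(* A real Hilbert space is a complete normed module [V] together with a
   positive definite symmetric bilinear form [ip : {dot V for idfun}] such that
   [norm_from_ip ip]. *)
Definition norm_from_ip (R : realType) (V : normedModType R)
    (ip : V -> V -> R) : Prop :=
  forall x, `|x| ^+ 2 = ip x x.

(* The inner product of the Hilbert direct sum. The library's norm on a product
   is the maximum norm, so metric notions on the direct sum are stated with this
   form instead. *)
Definition prod_ip (R : realType) (U V : lmodType R)
    (ipU : U -> U -> R) (ipV : V -> V -> R) (a b : U * V) : R :=
  ipU a.1 b.1 + ipV a.2 b.2.

Definition weak_cvg (R : realType) (V : lmodType R) (ip : V -> V -> R)
    (u : nat -> V) (l : V) : Prop :=
  forall w, (fun n => ip (u n) w) @ \oo --> ip l w.

Definition rlinear_cvg (R : realType) (V : lmodType R) (ip : V -> V -> R)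
    (u : nat -> V) (l : V) : Prop :=
  exists c r : R, [/\ 0 <= c, 0 < r < 1 &
    forall n, Num.sqrt (ip (u n - l) (u n - l)) <= c * r ^+ n].

Definition is_adjoint (R : realType) (U V : lmodType R)
    (ipU : U -> U -> R) (ipV : V -> V -> R) (L : U -> V) (Ls : V -> U) : Prop :=
  forall x v, ipV (L x) v = ipU x (Ls v).

Definition opnorm (R : realType) (U V : normedModType R) (L : U -> V) : R :=
  sup [set `|L x| | x in [set x : U | `|x| <= 1]].

Definition cocoercive (R : realType) (V : normedModType R) (ip : V -> V -> R)
    (beta : R) (C : V -> V) : Prop :=
  forall x y, ip (x - y) (C x - C y) >= beta * `|C x - C y| ^+ 2.

Definition monotone_map (R : realType) (V : lmodType R) (ip : V -> V -> R)
    (D : V -> V) : Prop :=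
  forall x y, 0 <= ip (x - y) (D x - D y).

(* Set-valued operators from [U] to [V] are functions [U -> set V]. *)
Definition gra (U V : Type) (E : U -> set V) : set (U * V) :=
  [set a | E a.1 a.2].

Definition op_inv (U V : Type) (E : U -> set V) : V -> set U :=
  fun v => [set x | E x v].

Definition op_of (U V : Type) (f : U -> V) : U -> set V := fun x => [set f x].

Definition op_add (U : Type) (V : zmodType) (E F : U -> set V) : U -> set V :=
  fun x => [set a + b | a in E x & b in F x].

Definition op_scale (R : realType) (U : Type) (V : lmodType R) (k : R)
    (E : U -> set V) : U -> set V :=
  fun x => [set k *: a | a in E x].

Definition resolvent (V : zmodType) (E : V -> set V) : V -> set V :=
  op_inv (op_add (op_of id) E).

Definition single_valued_full_domain (U V : Type) (E : U -> set V) : Prop :=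
  forall x, exists p, E x = [set p].

(* [M] and [N] stand for bounded self-adjoint linear operators. They enter the
   inequality only as functions, so the structure is not recorded in the type. *)
Definition semimonotone (R : realType) (V : lmodType R) (ip : V -> V -> R)
    (M N : V -> V) (S : set (V * V)) (E : V -> set V) : Prop :=
  forall x u y v, S (y, v) -> gra E (x, u) ->
    ip (x - y) (u - v) >= ip (x - y) (M (x - y)) + ip (u - v) (N (u - v)).

Definition seq_weak_strong_closed (R : realType) (V : lmodType R)
    (ip : V -> V -> R) (T : topologicalType) (S : set (V * T)) : Prop :=
  forall (x_ : nat -> V) (u_ : nat -> T) (x : V) (u : T),
    weak_cvg ip x_ x -> u_ @ \oo --> u -> (forall n, S (x_ n, u_ n)) -> S (x, u).

Definition sol_set (H G : zmodType) (L : H -> G) (Ls : G -> H)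
    (A : H -> set H) (B : G -> set G) (C D : H -> H) : set (H * G) :=
  [set a | [set b + Ls a.2 | b in op_add (op_add A (op_of C)) (op_of D) a.1] 0
           /\ B (L a.1) a.2].

Definition prod_opA (H G : zmodType) (L : H -> G) (Ls : G -> H)
    (A : H -> set H) (B : G -> set G) (D : H -> H) : H * G -> set (H * G) :=
  fun a => [set b + Ls a.2 | b in op_add A (op_of D) a.1] `*`
           [set y - L a.1 | y in op_inv B a.2].

Definition prod_opC (H G : zmodType) (C : H -> H) : H * G -> H * G :=
  fun a => (C a.1, 0).

Definition parallel_sum (R : realType) (a b : R) : R := a * b / (a + b).

(* The branches are exhaustive under [0 <= rhoA + rhoB], [0 <= muA + muB] and
   the requirement that a vanishing sum has vanishing terms. *)
Definition rho_hat (R : realType) (muA muB rhoA rhoB tau sigma : R) : R :=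
  if 0 < Num.min (rhoA + rhoB) (muA + muB) then
    Num.min 0 (Num.min (parallel_sum rhoA rhoB) (tau / sigma * parallel_sum muA muB))
  else if [&& rhoA == 0, rhoB == 0 & 0 < muA + muB] then
    Num.min 0 (tau / sigma * parallel_sum muA muB)
  else if [&& muA == 0, muB == 0 & 0 < rhoA + rhoB] then
    Num.min 0 (parallel_sum rhoA rhoB)
  else 0.

Definition eta_theta (R : realType) (V : lmodType R) (ip : V -> V -> R)
    (D : V -> V) (theta : R) : R :=
  if (1 <= theta < 2) && `[< monotone_map ip D >] then 1 else 1 + `|1 - theta|.

(* [delay a u n] is [u (n - 1)], with [u (-1) = a]. *)
Definition delay (T : Type) (a : T) (u : nat -> T) (n : nat) : T :=
  if n is m.+1 then u m else a.

(* Main.v *)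
(* Write Delta_n = (z_n, v_n) - (p_{n+1}, q_{n+1}) and let M be the
   preconditioner [1/tau, -L*; -L, 1/sigma], which kappa > 0 makes positive
   definite. The iteration is a relaxed preconditioned forward-reflected step:
   M Delta_n - (D-reflection + C z_n, 0) lies in the image of (p_{n+1}, q_{n+1})
   under the primal-dual operator. Adding the two semimonotonicity inequalities
   at a solution (x, u) and merging their quadratic terms by the parallel-sum
   inequality leaves the single, possibly negative, term rho_hat times a squared
   residual, and that residual is at most 1 + sqrt(sigma tau) |L| times a squared
   M-distance. Young inequalities then show that
     tau |(z_n, v_n) - (x, u)|_M^2 + 2 theta tau <z_n - x, D z_{n-1} - D p_n>
       + theta w |Delta_{n-1}|_M^2
   decreases by at least theta times the gap in the parameter condition times
   |Delta_n|_M^2. So Delta_n -> 0, the M-distance to every solution converges,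
   and Opial's argument gives weak convergence; if nu_A, nu_B > 0 the decrease
   controls the whole Lyapunov function, which therefore contracts. *)
Require Import Defs.
From HB Require Import structures.
From mathcomp Require Import all_boot all_order all_algebra.
From mathcomp Require Import all_classical all_reals all_analysis.
From mathcomp Require Import ring lra.
Set Implicit Arguments.
Unset Strict Implicit.
Unset Printing Implicit Defensive.
Import Order.TTheory GRing.Theory Num.Theory.
Import numFieldNormedType.Exports.
Local Open Scope classical_set_scope.
Local Open Scope ring_scope.

(** * Weak compactness and Opial's lemma *)

(** Forms are plain functions here so that the same theory serves the two Hilbert products, the
    direct sum form and the preconditioner metric. Definiteness is left out and supplied separately
    where a vector must be shown to vanish. *)
Definition semi_inner (R : realType) (V : lmodType R) (ip : V -> V -> R) : Prop :=
  [/\ forall x y, ip x y = ip y x,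
      forall a x y z, ip (a *: x + y) z = a * ip x z + ip y z &
      forall x, 0 <= ip x x].

(** Cauchy sequences are measured by the form itself, which lets the direct sum be complete for its
    Hilbert structure rather than for the maximum norm. *)
Definition ip_complete (R : realType) (V : lmodType R) (ip : V -> V -> R) : Prop :=
  forall u : nat -> V,
    (forall e, 0 < e -> exists N, forall m n, (N <= m)%N -> (N <= n)%N ->
       ip (u m - u n) (u m - u n) < e) ->
    exists l, (fun n => ip (u n - l) (u n - l)) @ \oo --> (0 : R).

Lemma ultra_fmap (T S : Type) (f : T -> S) (F : set_system T) :
  UltraFilter F -> UltraFilter (f @ F).
Proof.
move=> FU; split=> [|G GF sub]; first exact: fmap_proper_filter.
rewrite eqEsubset; split=> // A GA.
have [//|FnA] := in_ultra_setVsetC (f @^-1` A) FU.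
have /sub GnA : (f @ F) (~` A) by [].
by have [y []] := filter_ex (filterI GA GnA).
Qed.

(** Tails are preserved as soon as [f] dominates the identity, so subsequences are represented
    throughout by such an [f], without asking for monotonicity. *)
Lemma cvg_reindex (T : topologicalType) (s : nat -> T) (a : T) (f : nat -> nat) :
  (forall k, (k <= f k)%N) -> s @ \oo --> a -> (fun k => s (f k)) @ \oo --> a.
Proof.
move=> fk sa; apply: cvg_comp sa => A [N _ NA]; exists N => // n /= Nn.
by apply: NA => /=; exact: leq_trans Nn (fk n).
Qed.

(** * Cauchy-Schwarz, Riesz representation and weak compactness *)

Section SemiInner.
Context (R : realType) (V : lmodType R) (ip : V -> V -> R) (ipP : semi_inner ip).
Implicit Types (x y z : V) (u : nat -> V).

Lemma ipC x y : ip x y = ip y x.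
Proof. by case: ipP. Qed.

Lemma ip_ge0 x : 0 <= ip x x.
Proof. by case: ipP. Qed.

Lemma ipDl x y z : ip (x + y) z = ip x z + ip y z.
Proof. by case: ipP => _ /(_ 1 x y z) + _; rewrite scale1r mul1r. Qed.

Lemma ip0l z : ip 0 z = 0.
Proof. by apply: (addrI (ip 0 z)); rewrite -ipDl !addr0. Qed.

Lemma ipZl a x z : ip (a *: x) z = a * ip x z.
Proof. by case: ipP => _ /(_ a x 0 z) + _; rewrite ip0l !addr0. Qed.

Lemma ipNl x z : ip (- x) z = - ip x z.
Proof. by rewrite -scaleN1r ipZl mulN1r. Qed.

Lemma ipBl x y z : ip (x - y) z = ip x z - ip y z.
Proof. by rewrite ipDl ipNl. Qed.

Lemma ip0r z : ip z 0 = 0. Proof. by rewrite ipC ip0l. Qed.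

Lemma ipDr x y z : ip z (x + y) = ip z x + ip z y.
Proof. by rewrite !(ipC z) ipDl. Qed.

Lemma ipZr a x z : ip z (a *: x) = a * ip z x.
Proof. by rewrite !(ipC z) ipZl. Qed.

Lemma ipNr x z : ip z (- x) = - ip z x.
Proof. by rewrite !(ipC z) ipNl. Qed.

Lemma ipBr x y z : ip z (x - y) = ip z x - ip z y.
Proof. by rewrite ipDr ipNr. Qed.

Lemma ip_sqrD x y : ip (x + y) (x + y) = ip x x + 2 * ip x y + ip y y.
Proof. by rewrite ipDl !ipDr (ipC y x); ring. Qed.

Lemma ip_sqrB x y : ip (x - y) (x - y) = ip x x - 2 * ip x y + ip y y.
Proof. by rewrite ip_sqrD ipNr ipNl ipNr; ring. Qed.

Lemma cauchy_schwarz x y : (ip x y) ^+ 2 <= ip x x * ip y y.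
Proof.
have H a b : 0 <= a ^+ 2 * ip x x - 2 * (a * b * ip x y) + b ^+ 2 * ip y y.
  have := ip_ge0 (a *: x - b *: y).
  by rewrite ip_sqrB !(ipZl, ipZr); congr (_ <= _); ring.
(* The form may be degenerate, so a null [y] is treated apart: [H] is then affine in the cross term
   and forces [ip x y] to vanish. *)
have [y0|yn0] := eqVneq (ip y y) 0.
  have [x0|xn0] := eqVneq (ip x x) 0.
    have := H 1 1; have := H 1 (-1); rewrite x0 y0 => h1 h2.
    have -> : ip x y = 0 by lra.
    by rewrite expr0n mulr0.
  have x0 : 0 < ip x x by rewrite lt_def xn0 ip_ge0.
  have := H (ip x y) (ip x x); rewrite y0 => h.
  have : 0 <= ip x x * - (ip x y ^+ 2) by lra.
  by rewrite pmulr_rge0 // mulr0 oppr_ge0.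
have y0 : 0 < ip y y by rewrite lt_def yn0 ip_ge0.
have : 0 <= ip y y * (ip x x * ip y y - ip x y ^+ 2).
  by have := H (ip y y) (ip x y); congr (_ <= _); ring.
by rewrite pmulr_rge0 // subr_ge0.
Qed.

Lemma cauchy_schwarz_sqrt x y :
  `|ip x y| <= Num.sqrt (ip x x) * Num.sqrt (ip y y).
Proof.
rewrite -sqrtrM ?ip_ge0// -sqrtr_sqr ler_sqrt ?mulr_ge0 ?ip_ge0//.
exact: cauchy_schwarz.
Qed.

Lemma weak_of_strong {u} {l} :
  (fun n => ip (u n - l) (u n - l)) @ \oo --> (0 : R) -> weak_cvg ip u l.
Proof.
move=> ul w; apply/subr_cvg0/norm_cvg0P.
apply: (@squeeze_cvgr _ _ _ _ (fun=> 0) (fun n =>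
  Num.sqrt (ip (u n - l) (u n - l)) * Num.sqrt (ip w w))).
- by near=> n; rewrite normr_ge0/= -ipBl cauchy_schwarz_sqrt.
- exact: cvg_cst.
- rewrite -[0](mul0r (Num.sqrt (ip w w))); apply: cvgMr_tmp.
  rewrite -sqrtr0.
  exact: (cvg_comp _ _ ul (@sqrt_continuous R 0)).
Unshelve. all: by end_near. Qed.

Lemma linear_part_eq0 (g q : R) : 0 <= q ->
  (forall t, 0 <= 2 * t * g + t ^+ 2 * q) -> g = 0.
Proof.
move=> q0 h; apply/eqP; rewrite -sqrf_eq0 eq_le sqr_ge0 andbT.
have q1 : 0 < q + 1 by rewrite ltr_wpDl.
(* Dividing by [q + 1] instead of the minimiser's [q] also covers [q = 0], and still produces a
   negative multiple of [g ^+ 2]. *)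
have := h (- g / (q + 1)).
have -> : 2 * (- g / (q + 1)) * g + (- g / (q + 1)) ^+ 2 * q
  = g ^+ 2 * ((- (q + 2)) / (q + 1) ^+ 2) by field; lra.
have -> : - (q + 2) / (q + 1) ^+ 2 = - ((q + 2) / (q + 1) ^+ 2) by rewrite mulNr.
rewrite mulrN oppr_ge0 pmulr_lle0 // divr_gt0 ?exprn_gt0//; lra.
Qed.

(* Minimises the energy [ip x x - 2 * phi x] over [W]; the parallelogram law
   makes minimising sequences Cauchy. *)
Lemma riesz_on_closed_subspace (W : set V) (phi : V -> R) (K : R) :
  ip_complete ip ->
  W 0 -> (forall a x y, W x -> W y -> W (a *: x + y)) ->
  (forall u l, (forall n, W (u n)) ->
     (fun n => ip (u n - l) (u n - l)) @ \oo --> (0 : R) -> W l) ->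
  (forall a x y, phi (a *: x + y) = a * phi x + phi y) ->
  (forall x, phi x <= K * Num.sqrt (ip x x)) ->
  exists2 l, W l & forall w, W w -> ip l w = phi w.
Proof.
move=> cmpl W0 Wlin Wcl philin phiK.
pose J x := ip x x - 2 * phi x.
have Jlb x : - K ^+ 2 <= J x.
  rewrite /J -(sqr_sqrtr (ip_ge0 x)).
  have := phiK x; have := sqr_ge0 (Num.sqrt (ip x x) - K).
  by set s := Num.sqrt _; set p := phi x; lra.
have phiZ a x : phi (a *: x) = a * phi x.
  have p0 : phi 0 = 0.
    by have := philin 1 0 0; rewrite scaler0 add0r mul1r => h; lra.
  by have := philin a x 0; rewrite addr0 p0 addr0.
have phiD x y : phi (x + y) = phi x + phi y.
  by have := philin 1 x y; rewrite scale1r mul1r.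
have hasinf : has_inf [set J x | x in W].
  by split; [exists (J 0), 0 | exists (- K ^+ 2) => _ [x _ <-]].
pose I := inf [set J x | x in W].
have IJ x : W x -> I <= J x by move=> Wx; apply: ge_inf; [case: hasinf | exists x].
have approx n : exists x, W x /\ J x < I + n.+1%:R^-1.
  have [|_ [x Wx <-] h] := @inf_adherent _ _ n.+1%:R^-1 _ hasinf.
    by rewrite invr_gt0.
  by exists x.
have [u uP] := choice approx.
have par m n : ip (u m - u n) (u m - u n) <= 2 * m.+1%:R^-1 + 2 * n.+1%:R^-1.
  have [Wm Jm] := uP m; have [Wn Jn] := uP n.
  (* The midpoint has energy at least [I], and the squared distance of [u m] and [u n] is twice the
     sum of their energies minus four times that of the midpoint. *)
  have Wmid : W (2^-1 *: (u m + u n)).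
    have := Wlin 2^-1 (u m) (2^-1 *: u n) Wm.
    rewrite scalerDr; apply.
    by have := Wlin 2^-1 (u n) 0 Wn W0; rewrite addr0.
  have := IJ _ Wmid; move: Jm Jn; rewrite /J.
  rewrite phiZ phiD !(ipZl, ipZr) ip_sqrD ip_sqrB.
  by set a := m.+1%:R^-1; set b := n.+1%:R^-1; move=> *; lra.
have [e e0|l ul] := cmpl u.
  have e4 : 0 < e / 4 by rewrite divr_gt0.
  have [N _ hN] := near_infty_natSinv_lt (PosNum e4).
  exists N => m n Nm Nn; apply: le_lt_trans (par m n) _.
  have /= := hN _ Nm; have /= := hN _ Nn.
  by set a := m.+1%:R^-1; set b := n.+1%:R^-1; move=> *; lra.
have Wl : W l by apply: Wcl ul => n; case: (uP n).
exists l => // w Ww; apply/eqP; rewrite -subr_eq0; apply/eqP.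
apply: (@linear_part_eq0 _ (ip w w)) => [|t]; first exact: ip_ge0.
(* Perturbing the almost minimiser [u n] in the direction [w] gives the first-order condition up to
   the error [n.+1%:R^-1], which disappears in the limit. *)
have ineq n : - n.+1%:R^-1 <= 2 * t * (ip (u n) w - phi w) + t ^+ 2 * ip w w.
  have [Wn Jn] := uP n.
  have := IJ _ (Wlin t w (u n) Ww Wn); move: Jn; rewrite /J.
  rewrite philin ip_sqrD !(ipZl, ipZr) (ipC w).
  by set a := n.+1%:R^-1; move=> *; lra.
have c1 : (fun n => - (n.+1%:R^-1 : R)) @ \oo --> - (0 : R).
  by apply: cvgN; exact: cvg_harmonic.
have c2 : (fun n => 2 * t * (ip (u n) w - phi w) + t ^+ 2 * ip w w) @ \oo -->
  2 * t * (ip l w - phi w) + t ^+ 2 * ip w w.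
  apply: cvgD; last exact: cvg_cst.
  apply: cvgMl_tmp; apply: cvgB; last exact: cvg_cst.
  exact: weak_of_strong ul w.
rewrite -oppr0; apply: ler_cvg_to c1 c2 _.
by near=> n.
Unshelve. all: by end_near. Qed.

(* An ultrafilter limit of the functionals [ip (u n)] is represented by some
   [l], and choosing one index per [k] close to [l] on the first [k] terms
   replaces the diagonal extraction of a subsequence. *)
Lemma weak_sequential_compactness u (K : R) : ip_complete ip ->
  (forall n, ip (u n) (u n) <= K) ->
  exists f : nat -> nat, (forall k, (k <= f k)%N) /\
    exists l, weak_cvg ip (u \o f) l.
Proof.
move=> cmpl uK.
have K0 : 0 <= K by apply: le_trans (uK 0%N); exact: ip_ge0.
have [U [UU ooU]] := ultraFilterLemma (@eventually_filter).
(* The values lie in a compact segment, so they converge along the ultrafilter [U]; the bound on the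
   limit makes [phi] a bounded functional. *)
have ulim w : exists a : R, `|a| <= Num.sqrt K * Num.sqrt (ip w w) /\
    (fun n => ip (u n) w) @ U --> a.
  set b := _ * _.
  have ub n : `|ip (u n) w| <= b.
    apply: le_trans (cauchy_schwarz_sqrt _ _) _.
    by rewrite ler_wpM2r ?sqrtr_ge0// ler_sqrt.
  have := @segment_compact R (- b) b; rewrite compact_ultra.
  move=> /(_ ((fun n => ip (u n) w) @ U) (ultra_fmap _ UU)) [|a [ab Ua]].
    by apply: ooU; exists 0%N => // n _ /=; rewrite in_itv/= -ler_norml.
  by exists a; split=> //; move: ab; rewrite /= in_itv/= -ler_norml.
have [phi phiP] := choice ulim.
have philim w : (fun n => ip (u n) w) @ U --> phi w by case: (phiP w).
have phi_uniq w a : (fun n => ip (u n) w) @ U --> a -> phi w = a.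
  by move=> h; apply: (@cvg_unique _ (@Rhausdorff R) _ _ _ _ (philim w) h).
have [||||||l _ lphi] := @riesz_on_closed_subspace setT phi (Num.sqrt K) => //.
- move=> a x y; apply: phi_uniq.
  under eq_fun do rewrite ipDr ipZr.
  by apply: cvgD => //; apply: cvgMl_tmp.
- by move=> x; apply: le_trans (ler_norm _) _; case: (phiP x).
have {}lphi w : (fun n => ip (u n) w) @ U --> ip l w by rewrite lphi.
have pick k : exists n, [/\ (k <= n)%N, `|ip l l - ip (u n) l| < k.+1%:R^-1 &
    forall m, (m <= k)%N -> `|ip l (u m) - ip (u n) (u m)| < k.+1%:R^-1].
  have k0 : 0 < k.+1%:R^-1 :> R by rewrite invr_gt0.
  have near1 w : \forall n \near U, `|ip l w - ip (u n) w| < k.+1%:R^-1.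
    exact: (cvgrPdist_lt _ _).1 (lphi w) _ k0.
  have near2 j : \forall n \near U, forall m, (m < j)%N ->
      `|ip l (u m) - ip (u n) (u m)| < k.+1%:R^-1.
    elim: j => [|j IH]; first by near=> n.
    near=> n => m; rewrite ltnS leq_eqVlt => /predU1P[->|].
      by near: n; exact: near1.
    by move: m; near: n.
  have near3 : \forall n \near U, (k <= n)%N by apply: ooU; exact: nbhs_infty_ge.
  have [n [[h1 h2] h3]] := filter_ex (filterI (filterI near3 (near1 l)) (near2 k.+1)).
  by exists n; split.
have [f fP] := choice pick.
exists f; split; [by move=> k; case: (fP k)|exists l].
(* The test vectors for which the extracted sequence converges as wanted form a closed subspace
   containing [l] and every [u m]. *)
pose W := [set w | (fun n => ip ((u \o f) n) w) @ \oo --> ip l w].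
have Wl : W l.
  apply/cvgrPdist_lt => e e0; have [N _ hN] := near_infty_natSinv_lt (PosNum e0).
  exists N => // n /= Nn; case: (fP n) => _ h _.
  exact: lt_trans h (hN _ Nn).
have Wu m : W (u m).
  apply/cvgrPdist_lt => e e0; have [N _ hN] := near_infty_natSinv_lt (PosNum e0).
  exists (maxn N m) => // n /=; rewrite geq_max => /andP[Nn mn].
  by case: (fP n) => _ _ /(_ m mn) h; exact: lt_trans h (hN _ Nn).
have Wlin a x y : W x -> W y -> W (a *: x + y).
  rewrite /W/= => Wx Wy; under eq_fun do rewrite ipDr ipZr.
  by rewrite ipDr ipZr; apply: cvgD => //; apply: cvgMl_tmp.
have W0 : W 0.
  rewrite /W/= ip0r; under eq_fun do rewrite ip0r; exact: cvg_cst.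
have Wcl (x : nat -> V) y : (forall n, W (x n)) ->
    (fun n => ip (x n - y) (x n - y)) @ \oo --> (0 : R) -> W y.
  move=> Wx xy; apply/cvgrPdist_lt => e e0.
  (* [B] dominates the sum of the norms of [l] and of any [u (f k)]; the summand 1 makes it
     positive, so that one can divide by it. *)
  pose B := 1 + Num.sqrt K + Num.sqrt (ip l l).
  have B0 : 0 < B by rewrite /B -addrA ltr_pwDl// addr_ge0// sqrtr_ge0.
  have [n sn] : exists n, Num.sqrt (ip (x n - y) (x n - y)) < e / 2 / B.
    have := cvg_comp _ _ xy (@sqrt_continuous R 0); rewrite sqrtr0 => h.
    have e2B : 0 < e / 2 / B by rewrite !divr_gt0.
    have [N _ /(_ N)/(_ (leqnn N)) hN] := (cvgr0Pnorm_lt _).1 h _ e2B.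
    by exists N; apply: le_lt_trans hN; exact: ler_norm.
  move: sn; set s := Num.sqrt _ => sn.
  have s0 : 0 <= s by exact: sqrtr_ge0.
  have sB : s * B < e / 2 by rewrite -ltr_pdivlMr.
  have e2 : 0 < e / 2 by rewrite divr_gt0.
  have [N _ hN] := (cvgrPdist_lt _ _).1 (Wx n) _ e2.
  exists N => // k /hN /= h.
  have fk1 : `|ip (u (f k)) (x n - y)| <= Num.sqrt K * s.
    apply: le_trans (cauchy_schwarz_sqrt _ _) _.
    by rewrite ler_wpM2r// ler_sqrt.
  have fk2 : `|ip l (x n - y)| <= Num.sqrt (ip l l) * s.
    exact: cauchy_schwarz_sqrt.
  have -> : ip l y - ip (u (f k)) y = (ip l (x n) - ip (u (f k)) (x n))
      - ip l (x n - y) + ip (u (f k)) (x n - y) by rewrite !ipBr; ring.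
  apply: le_lt_trans (ler_normD _ _) _; apply: le_lt_trans (lerD (ler_normB _ _) fk1) _.
  by move: sB fk2 h; rewrite /B; set a1 := `|_|; set a2 := `|_|; nra.
move=> w.
(* Riesz on [W] yields the projection [w'] of an arbitrary [w]. Since [l] and all [u (f k)] lie in
   [W], testing against [w] is the same as testing against [w']. *)
have [||||||w' Ww' w'P] := @riesz_on_closed_subspace W (ip w) (Num.sqrt (ip w w)) => //.
- by move=> a x y; rewrite ipDr ipZr.
- by move=> x; apply: le_trans (ler_norm _) _; exact: cauchy_schwarz_sqrt.
have E x : W x -> ip x w = ip x w' by move=> /w'P; rewrite !(ipC x).
rewrite E//; under eq_fun do rewrite /= E//.
exact: Ww'.
Unshelve. all: by end_near. Qed.

End SemiInner.

(* Two weak cluster points [a] and [b] are separated by [fun x => M x (a - b)],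
   which converges along the whole sequence. *)
Lemma opial (R : realType) (V : lmodType R) (ip M : V -> V -> R) (S : set V)
    (u : nat -> V) (K : R) :
  semi_inner ip -> ip_complete ip ->
  (forall n, ip (u n) (u n) <= K) ->
  semi_inner M -> (forall x, M x x = 0 -> x = 0) ->
  (forall w, exists w', forall x, M x w = ip x w') ->
  (forall a, S a -> cvgn (fun n => M (u n - a) (u n - a))) ->
  (forall f a, (forall k, (k <= f k)%N) -> weak_cvg ip (u \o f) a -> S a) ->
  exists2 a, S a & weak_cvg ip u a.
Proof.
move=> ipP cmpl uK MP Mdef Mrep Mcv cluster.
have ge_trans (f g : nat -> nat) : (forall k, (k <= f k)%N) ->
    (forall k, (k <= g k)%N) -> forall k, (k <= (f \o g) k)%N.
  by move=> hf hg k; apply: leq_trans (hg k) (hf _).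
have unique f g a b : (forall k, (k <= f k)%N) -> (forall k, (k <= g k)%N) ->
    weak_cvg ip (u \o f) a -> weak_cvg ip (u \o g) b -> a = b.
  move=> fk gk fa gb.
  have /Mcv/cvg_ex[/= ca cvA] : S a by exact: cluster fa.
  have /Mcv/cvg_ex[/= cb cvB] : S b by exact: cluster gb.
  have [w' w'E] := Mrep (a - b).
  (* Polarization: the quadratic term in [u n] cancels, so the inner product with [a - b] is a
     combination of the two convergent distances. *)
  have lin n : ip (u n) w' = 2^-1 * (M (u n - b) (u n - b) - M (u n - a) (u n - a)
      + M a a - M b b).
    by rewrite -w'E !(ip_sqrB MP) (ipBr MP); field.
  have cv : (fun n => ip (u n) w') @ \oo --> 2^-1 * (cb - ca + M a a - M b b).
    under eq_fun do rewrite lin.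
    apply: cvgMl_tmp; apply: cvgB; last exact: cvg_cst.
    by apply: cvgD; [exact: cvgB|exact: cvg_cst].
  have ea := cvg_unique (@Rhausdorff R) (cvg_reindex fk cv) (fa w').
  have eb := cvg_unique (@Rhausdorff R) (cvg_reindex gk cv) (gb w').
  apply/eqP; rewrite -subr_eq0; apply/eqP/Mdef.
  by rewrite {1}(ipBl MP) !w'E -ea -eb subrr.
have [f [fk [a fa]]] := weak_sequential_compactness ipP cmpl uK.
exists a; first exact: cluster fa.
apply: contrapT => /existsNP[w /cvgrPdist_lt].
move=> /existsNP[e /not_implyP[e0 ne]].
(* If [u] failed to converge weakly to [a], indices keeping a distance [e] at the test vector [w]
   would have a further weak cluster point, equal to [a] by uniqueness. *)
have bad k : exists n, (k <= n)%N /\ e <= `|ip a w - ip (u n) w|.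
  apply: contrapT => h; apply: ne; exists k => // n /= kn.
  by rewrite ltNge; apply/negP => hn; apply: h; exists n.
have [g gP] := choice bad.
have [|h [hk [b hb]]] := weak_sequential_compactness ipP (u := u \o g) cmpl (K := K).
  by move=> n; exact: uK.
have ghk : forall k, (k <= (g \o h) k)%N.
  by apply: ge_trans => // k; case: (gP k).
have ab : a = b by exact: (unique f (g \o h)).
have := (cvgrPdist_lt _ _).1 (hb w) _ e0 => -[N _ /(_ N)/(_ (leqnn N))]/=.
by rewrite -ab ltNge; case: (gP (h N)) => _ ->.
Qed.

(** * The Hilbert direct sum *)

Section ProductInner.
Context (R : realType) (U V : lmodType R) (ipU : U -> U -> R) (ipV : V -> V -> R).
Context (PU : semi_inner ipU) (PV : semi_inner ipV).

Lemma prod_semi_inner : semi_inner (prod_ip ipU ipV).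
Proof.
split=> [x y|a x y z|x]; rewrite /prod_ip/=.
- by rewrite (ipC PU) (ipC PV).
- by rewrite !(ipDl PU, ipDl PV, ipZl PU, ipZl PV); ring.
- by rewrite addr_ge0 ?(ip_ge0 PU) ?(ip_ge0 PV).
Qed.

Lemma prod_ip_complete :
  ip_complete ipU -> ip_complete ipV -> ip_complete (prod_ip ipU ipV).
Proof.
move=> cU cV u uC.
have [e e0|l1 h1] := cU (fun n => (u n).1).
  have [N hN] := uC e e0; exists N => m n Nm Nn; apply: le_lt_trans (hN m n Nm Nn).
  by rewrite /prod_ip lerDl (ip_ge0 PV).
have [e e0|l2 h2] := cV (fun n => (u n).2).
  have [N hN] := uC e e0; exists N => m n Nm Nn; apply: le_lt_trans (hN m n Nm Nn).
  by rewrite /prod_ip lerDr (ip_ge0 PU).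
exists (l1, l2); have hh := cvgD h1 h2; rewrite addr0 in hh.
exact: hh.
Qed.

End ProductInner.

(** * The preconditioner and the Lyapunov function *)

(** Arithmetic-geometric mean: [4 * b ^+ 2] is at most [(x + y) ^+ 2]. *)
Lemma sum_ge0_of_sqr_le (R : realDomainType) (x y b : R) : 0 <= x -> 0 <= y ->
  b ^+ 2 <= x * y -> 0 <= x + 2 * b + y.
Proof.
move=> x0 y0 h; rewrite leNgt; apply/negP => hn.
have h1 : 0 < (- 2 * b - (x + y)) * (- 2 * b + (x + y)) by rewrite mulr_gt0; lra.
by have := sqr_ge0 (x - y); lra.
Qed.

(** A nonincreasing sequence bounded below converges, so its consecutive differences vanish, and
    these dominate [c * W n]. *)
Lemma decreasing_by_cvg0 (R : realType) (V W : nat -> R) (c : R) : 0 < c ->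
  (forall n, 0 <= V n) -> (forall n, 0 <= W n) ->
  (forall n, V n.+1 <= V n - c * W n) -> cvgn V /\ W @ \oo --> (0 : R).
Proof.
move=> c0 V0 W0 VW.
have cv : cvgn V.
  apply: nonincreasing_is_cvgn; last by exists 0 => _ [n _ <-].
  apply/nonincreasing_seqP => n; apply: le_trans (VW n) _.
  by rewrite gerBl mulr_ge0// ltW.
split=> //; have /cvg_ex[l Vl] := cv.
have d0 : (fun n => c^-1 * (V n - V n.+1)) @ \oo --> (0 : R).
  rewrite -[0](mulr0 c^-1); apply: cvgMl_tmp; rewrite -(subrr l).
  by apply: cvgB => //; rewrite cvg_shiftS.
apply: squeeze_cvgr (cvg_cst 0) d0; near=> n.
by rewrite W0 ler_pdivlMl//; have := VW n; lra.
Unshelve. all: by end_near. Qed.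

(** * The preconditioner metric and one step of the iteration *)

Section Preconditioner.
Context (R : realType) (U V : lmodType R) (ipU : U -> U -> R) (ipV : V -> V -> R).
Context (PU : semi_inner ipU) (PV : semi_inner ipV).
Context (L : {linear U -> V}) (Ls : V -> U) (adj : is_adjoint ipU ipV L Ls).
Context (m tau sigma : R) (m0 : 0 <= m) (tau0 : 0 < tau) (sigma0 : 0 < sigma).
Context (Lm : forall x, ipV (L x) (L x) <= m ^+ 2 * ipU x x).

Let tn0 : tau != 0. Proof. by rewrite gt_eqF. Qed.
Let sn0 : sigma != 0. Proof. by rewrite gt_eqF. Qed.

Let LB x y : L (x - y) = L x - L y. Proof. exact: linearB. Qed.
Let LZ c x : L (c *: x) = c *: L x. Proof. exact: linearZ_LR. Qed.

Local Notation uE := (ipDl PU, ipDr PU, ipNl PU, ipNr PU, ipZl PU, ipZr PU).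
Local Notation vE := (ipDl PV, ipDr PV, ipNl PV, ipNr PV, ipZl PV, ipZr PV).

(** By adjointness the left side is the product of [L (Ls v)] with [v]; Cauchy-Schwarz and [Lm]
    bound its square, and one factor is cancelled. *)
Lemma adjoint_bound v : ipU (Ls v) (Ls v) <= m ^+ 2 * ipV v v.
Proof.
have h : (ipU (Ls v) (Ls v)) ^+ 2 <= ipU (Ls v) (Ls v) * (m ^+ 2 * ipV v v).
  rewrite -{1}adj; apply: le_trans (cauchy_schwarz PV _ _) _.
  by rewrite mulrCA mulrA ler_wpM2r// ?(ip_ge0 PV).
have [->|n0] := eqVneq (ipU (Ls v) (Ls v)) 0.
  by rewrite mulr_ge0 ?(ip_ge0 PV)// exprn_ge0.
by move: h; rewrite expr2 ler_pM2l// lt_def n0 (ip_ge0 PU).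
Qed.

(* The metric [<a, M b>] of the preconditioner [M = [1/tau, -L*; -L, 1/sigma]]. *)
Definition precond (a b : U * V) : R :=
  tau^-1 * ipU a.1 b.1 - ipV (L a.1) b.2 - ipV (L b.1) a.2 + sigma^-1 * ipV a.2 b.2.

Definition precond1 (a : U * V) : U := tau^-1 *: a.1 - Ls a.2.
Definition precond2 (a : U * V) : V := sigma^-1 *: a.2 - L a.1.

Lemma precondE a b :
  precond a b = prod_ip ipU ipV a (precond1 b, precond2 b).
Proof.
by rewrite /precond /prod_ip /precond1 /precond2 /= !(uE, vE) -adj (ipC PV (L b.1)); ring.
Qed.

Local Notation kappa := (1 - sigma * tau * m ^+ 2).
Local Notation k := (Num.sqrt (sigma * tau) * m).

(** Completing the square in the dual variable: the excess is [tau / sigma] times the squared norm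
    of [sigma *: L a.1 - a.2], plus the slack in [Lm]. *)
Lemma precond_ge_fst a : kappa * ipU a.1 a.1 <= tau * precond a a.
Proof.
have y : 0 <= ipV (sigma *: L a.1 - a.2) (sigma *: L a.1 - a.2) by exact: ip_ge0.
have := Lm a.1; move: y; rewrite /precond (ip_sqrB PV) !vE.
set x1 := ipV (L _) (L _); set x2 := ipV (L _) _; set x3 := ipV a.2 _.
set x4 := ipU _ _ => h1 h2.
have st : 0 < sigma * tau by rewrite mulr_gt0.
have h3 : 0 <= sigma^-1 * tau * (sigma * (sigma * x1) - 2 * (sigma * x2) + x3).
  by rewrite !mulr_ge0 ?invr_ge0 ?(ltW sigma0) ?(ltW tau0).
have h4 : (sigma * tau) * x1 <= sigma * tau * (m ^+ 2 * x4) by rewrite ler_pM2l.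
have e3 : sigma^-1 * tau * (sigma * (sigma * x1) - 2 * (sigma * x2) + x3) =
  sigma * tau * x1 - 2 * tau * x2 + tau * sigma^-1 * x3 by field; rewrite ?tn0 ?sn0.
rewrite e3 in h3.
have -> : tau * (tau^-1 * x4 - x2 - x2 + sigma^-1 * x3) =
  x4 - 2 * tau * x2 + tau * sigma^-1 * x3 by field; rewrite ?tn0 ?sn0.
by lra.
Qed.

(** The same completion of the square with the roles of the spaces exchanged and [adjoint_bound] in
    place of [Lm]. *)
Lemma precond_ge_snd a : kappa * ipV a.2 a.2 <= sigma * precond a a.
Proof.
have y : 0 <= ipU (tau *: Ls a.2 - a.1) (tau *: Ls a.2 - a.1) by exact: ip_ge0.
have := adjoint_bound a.2; move: y; rewrite /precond (ip_sqrB PU) !uE adj.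
rewrite (ipC PU (Ls _) a.1).
set x1 := ipU (Ls _) (Ls _); set x2 := ipU _ (Ls _); set x3 := ipU a.1 _.
set x4 := ipV _ _ => h1 h2.
have st : 0 < sigma * tau by rewrite mulr_gt0.
have h3 : 0 <= tau^-1 * sigma * (tau * (tau * x1) - 2 * (tau * x2) + x3).
  by rewrite !mulr_ge0 ?invr_ge0 ?(ltW sigma0) ?(ltW tau0).
have h4 : (sigma * tau) * x1 <= sigma * tau * (m ^+ 2 * x4) by rewrite ler_pM2l.
have e3 : tau^-1 * sigma * (tau * (tau * x1) - 2 * (tau * x2) + x3) =
  sigma * tau * x1 - 2 * sigma * x2 + sigma * tau^-1 * x3 by field; rewrite ?tn0 ?sn0.
rewrite e3 in h3.
have -> : sigma * (tau^-1 * x3 - x2 - x2 + sigma^-1 * x4) =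
  x4 - 2 * sigma * x2 + sigma * tau^-1 * x3 by field; rewrite ?tn0 ?sn0.
by lra.
Qed.

Lemma k_sqr : k ^+ 2 = sigma * tau * m ^+ 2.
Proof. by rewrite exprMn sqr_sqrtr// mulr_ge0// ltW. Qed.

Lemma k_ge0 : 0 <= k. Proof. by rewrite mulr_ge0// sqrtr_ge0. Qed.

(** The product of the two diagonal terms is [m ^+ 2] times that of the squared norms, which is what
    Cauchy-Schwarz allows the squared cross term to reach. *)
Lemma cross_bound a :
  0 <= k * (tau^-1 * ipU a.1 a.1 + sigma^-1 * ipV a.2 a.2) + 2 * ipV (L a.1) a.2.
Proof.
have -> : k * (tau^-1 * ipU a.1 a.1 + sigma^-1 * ipV a.2 a.2) + 2 * ipV (L a.1) a.2
 = k * tau^-1 * ipU a.1 a.1 + 2 * ipV (L a.1) a.2 + k * sigma^-1 * ipV a.2 a.2 by ring.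
have kt : 0 <= k * tau^-1 by rewrite mulr_ge0 ?k_ge0// invr_ge0 ltW.
have ks : 0 <= k * sigma^-1 by rewrite mulr_ge0 ?k_ge0// invr_ge0 ltW.
have kU := mulr_ge0 kt (ip_ge0 PU a.1); have kV := mulr_ge0 ks (ip_ge0 PV a.2).
apply: (sum_ge0_of_sqr_le kU kV).
apply: le_trans (cauchy_schwarz PV _ _) _.
have -> : k * tau^-1 * ipU a.1 a.1 * (k * sigma^-1 * ipV a.2 a.2)
  = k ^+ 2 * (tau^-1 * sigma^-1) * ipU a.1 a.1 * ipV a.2 a.2 by ring.
have -> : k ^+ 2 * (tau^-1 * sigma^-1) = m ^+ 2 by rewrite k_sqr; field; rewrite ?tn0 ?sn0.
by rewrite ler_wpM2r// (ip_ge0 PV).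
Qed.

Lemma precond_le a :
  precond a a <= (1 + k) * (tau^-1 * ipU a.1 a.1 + sigma^-1 * ipV a.2 a.2).
Proof.
have := cross_bound a; rewrite /precond.
by move: k (tau^-1) (sigma^-1) (ipU _ _) (ipV _ _) (ipV _ _) => *; lra.
Qed.

Context (kappa0 : 0 < kappa).

Lemma k_lt1 : k < 1.
Proof.
have : k ^+ 2 < 1 by rewrite k_sqr -subr_gt0.
by rewrite expr_lt1// k_ge0.
Qed.

Lemma precond_semi_inner : semi_inner precond.
Proof.
split=> [x y|a x y z|x].
- by rewrite /precond (ipC PU) (ipC PV x.2); ring.
- by rewrite /precond/= !linearD !linearZ /= !(uE, vE); ring.
- have := precond_ge_fst x => h.
  rewrite -(pmulr_rge0 _ tau0); apply: le_trans h.
  by rewrite mulr_ge0 ?(ip_ge0 PU)// ltW.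
Qed.

(* With [K := [0, sqrt (sigma tau) L*; sqrt (sigma tau) L, 0]] of norm at most
   [k], the rescaled preconditioner is [1 - K] and the difference of the two
   sides is the sum of the quadratic form of [k^2 - K^2] at [a] and that of
   [(k + K) / (1 - k)] at [(1 - k) a - (tau h, 0)]. *)
Lemma precond_residual_le a h :
  tau * ipU (precond1 a - h) (precond1 a - h)
    + sigma * ipV (precond2 a) (precond2 a)
  <= (1 + k) * (precond a a - 2 * ipU a.1 h + tau / kappa * ipU h h).
Proof.
have k1 : 0 < 1 - k by have := k_lt1; lra.
have k2 : 0 < 1 + k by have := k_ge0; lra.
have Q := cross_bound ((1 - k) *: a.1 - tau *: h, (1 - k) *: a.2).
have h1 := Lm a.1; have h2 := adjoint_bound a.2.
have Q' := mulr_ge0 (ltW (etrans (invr_gt0 (1 - k)) k1)) Q.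
have h1' : 0 <= sigma * (m ^+ 2 * ipU a.1 a.1 - ipV (L a.1) (L a.1)).
  by rewrite mulr_ge0 ?(ltW sigma0)// subr_ge0.
have h2' : 0 <= tau * (m ^+ 2 * ipV a.2 a.2 - ipU (Ls a.2) (Ls a.2)).
  by rewrite mulr_ge0 ?(ltW tau0)// subr_ge0.
have mE : m ^+ 2 = k ^+ 2 / (sigma * tau) by rewrite k_sqr; field; rewrite ?tn0 ?sn0.
have kE : kappa = (1 - k) * (1 + k).
  by have := k_sqr; set K := k => e; rewrite -e; ring.
(* The three nonnegative quantities [Q'], [h1'] and [h2'] add up to exactly the difference of the
   sides, so an identity in the elementary products remains. *)
rewrite -subr_ge0; apply: le_trans (addr_ge0 (addr_ge0 Q' h1') h2') _.
rewrite le_eqVlt; apply/orP; left; apply/eqP.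
rewrite kE mE /= /precond /precond1 /precond2.
rewrite /= !LB !LZ !(uE, vE).
set x3 := ipU (Ls a.2) (Ls a.2).
rewrite (ipC PU h (Ls _)) (ipC PU h a.1) (ipC PU (Ls _) a.1) -!adj.
rewrite (ipC PU (Ls _) h) -!adj (ipC PV a.2 (L _)).
move: k1 k2; set K := k => k1 k2.
set x1 := ipU a.1 a.1; set x2 := ipV (L a.1) (L a.1);
set x4 := ipV a.2 a.2; set x5 := ipV (L a.1) a.2; set x6 := ipU a.1 h.
set x7 := ipU h h; set x8 := ipV (L h) a.2.
have := gt_eqF k1; have := gt_eqF k2 => k1n k2n.
by field; rewrite tn0 sn0 k1n k2n.
Qed.

Context (theta vartheta beta rho eta : R).
Context (theta0 : 0 < theta) (vartheta0 : 0 <= vartheta) (rho0 : rho <= 0).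
Local Notation chi := (1 + k).
Local Notation alpha := (tau * vartheta / kappa).
Local Notation beta' := (beta * kappa + chi * rho * (1 + vartheta / kappa)).
Context (beta'_gt0 : 0 < beta').

(* The weight of the previous step length in the Lyapunov function and the
   decrease per step, the latter being the gap in the parameter condition. *)
Definition lyap_weight : R :=
  tau * alpha - 2 * chi * rho * ((1 + 2 * alpha) * alpha + 2 * tau ^+ 2 * vartheta / kappa).
Definition lyap_gap : R :=
  tau * (2 - theta - 2 * tau * (eta * vartheta / kappa)) -
    ((tau + 2 * chi * rho) ^+ 2 / (2 * beta')
    - 2 * chi * rho * ((2 * tau * (vartheta / kappa) + 1) ^+ 2
                       + 4 * tau ^+ 2 * (vartheta / kappa))).

Lemma young (W : lmodType R) (ip : W -> W -> R) (x y : W) (s : R) :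
  semi_inner ip -> 0 < s -> 2 * ip x y <= s * ip x x + s^-1 * ip y y.
Proof.
move=> P s0; have := ip_ge0 P (s *: x - y).
rewrite (ip_sqrB P) !(ipZl P, ipZr P) => h.
have := mulr_ge0 (ltW (etrans (invr_gt0 s) s0)) h.
have -> : s^-1 * (s * (s * ip x x) - 2 * (s * ip x y) + ip y y) =
  s * ip x x - 2 * ip x y + s^-1 * ip y y by field; rewrite gt_eqF.
by move: (s^-1) => s' *; lra.
Qed.

(** Young's inequality with weight [(c * s)^-1] makes both terms carry a single factor [c]. The
    weight does not exist for [c = 0], where [x] is null, and the absolute value comes from using
    [x] and its opposite. *)
Lemma young_lipschitz (W : lmodType R) (ip : W -> W -> R) (x y : W) (c X s : R) :
  semi_inner ip -> 0 <= c -> ip x x <= c ^+ 2 * X -> 0 < s ->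
  2 * `|ip x y| <= c * (s^-1 * X + s * ip y y).
Proof.
move=> P c0 xX s0.
have [c00|cn0] := eqVneq c 0.
  have x0 : ip x x = 0.
    apply/eqP; rewrite eq_le (ip_ge0 P) andbT; apply: le_trans xX _.
    by rewrite c00 expr0n mul0r.
  have := cauchy_schwarz P x y; rewrite x0 mul0r => h.
  have /eqP -> : ip x y == 0 by rewrite -sqrf_eq0 eq_le h sqr_ge0.
  by rewrite normr0 mulr0 c00 mul0r.
have cp : 0 < c by rewrite lt_def cn0.
have sc : 0 < (c * s)^-1 by rewrite invr_gt0 mulr_gt0.
have gen z : ip z z = ip x x -> 2 * ip z y <= c * (s^-1 * X + s * ip y y).
  move=> zx; apply: le_trans (young z y P sc) _; rewrite zx invrK.
  apply: le_trans (lerD (ler_wpM2l (ltW sc) xX) (lexx _)) _.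
  rewrite le_eqVlt; apply/orP; left; apply/eqP.
  by field; rewrite gt_eqF// cn0.
have h1 := gen x erefl.
have h2 : 2 * ip (- x) y <= c * (s^-1 * X + s * ip y y).
  by apply: gen; rewrite (ipNl P) (ipNr P) opprK.
rewrite (ipNl P) in h2.
by case: (ger0P (ip x y)) => _; [exact: h1|exact: h2].
Qed.

(** One step of the Lyapunov decrease. Here [a] is the iterate minus a solution, [D] the
    displacement towards the resolvent point (not the operator), [c] the difference of the values of
    the cocoercive map, and [r], [r'] the old and new reflection errors; [dd0] and [S0] measure the
    previous displacement, and [N] is the strong monotonicity surplus. *)
Lemma descent_step (a D : U * V) (c r r' : U) (dd0 S0 N : R) :
  ipU r r <= vartheta ^+ 2 * dd0 -> kappa * dd0 <= tau * S0 ->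
  ipU r' r' <= vartheta ^+ 2 * ipU D.1 D.1 ->
  (1 - theta) * ipU D.1 r' <= (eta - 1) * vartheta * ipU D.1 D.1 ->
  1 <= eta ->
  beta * ipU c c <= ipU a.1 c ->
  ipU (a.1 - D.1) (r' - r + c)
   + rho * (ipU (precond1 D - (r' - r + c)) (precond1 D - (r' - r + c))
     + sigma / tau * ipV (precond2 D) (precond2 D)) + N <= precond (a - D) D ->
  tau * precond (a - theta *: D) (a - theta *: D)
    + 2 * theta * tau * ipU (a.1 - theta *: D.1) r'
    + theta * lyap_weight * precond D D
  <= tau * precond a a + 2 * theta * tau * ipU a.1 r + theta * lyap_weight * S0
     - theta * lyap_gap * precond D D - 2 * theta * tau * N.
Proof.
move=> hr hS0 hr' hmon eta1 hc hsemi.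
pose PM := precond_semi_inner.
pose t := tau / kappa.
have kn0 : kappa != 0 by rewrite gt_eqF.
have t0 : 0 < t by rewrite divr_gt0.
set S := precond D D; set dd := ipU D.1 D.1.
have S_ge0 : 0 <= S by exact: ip_ge0 PM D.
have F1 : dd <= t * S.
  by rewrite /t mulrAC ler_pdivlMr// mulrC; exact: precond_ge_fst.
have F1' : dd0 <= t * S0 by rewrite /t mulrAC ler_pdivlMr// mulrC.
have F2 := precond_residual_le D (r' - r + c).
have F3 := young_lipschitz D.1 PU vartheta0 hr ltr01.
have F3' := young_lipschitz D.1 PU vartheta0 hr' ltr01.
rewrite invr1 !mul1r -/dd in F3 F3'.
have F4 : ipU (r' - r) (r' - r) <= vartheta ^+ 2 * (2 * (dd + dd0)).
  have := ip_ge0 PU (r' + r); rewrite (ip_sqrD PU) (ip_sqrB PU).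
  by move: (ipU r' r) hr hr'; rewrite -/dd => x *; lra.
(* The weight [kappa^-1] is chosen so that, after multiplication by [t], the coefficient of
   [ipU c c] is the [vartheta / kappa] share occurring in [beta']. *)
have F5 := young_lipschitz c PU vartheta0 F4 (etrans (invr_gt0 _) kappa0).
rewrite invrK in F5.
have bn0 : beta' != 0 by rewrite gt_eqF.
(* The Young weight [2 * t * beta'] spends everything that cocoercivity provides in [ipU c c] once
   the residual term, with its negative [rho], has taken its part. *)
have F6 : (tau + 2 * chi * rho) * (2 * ipU D.1 c) <=
   (2 * tau * beta + 2 * chi * rho * t * (1 + vartheta / kappa)) * ipU c c
   + (tau + 2 * chi * rho) ^+ 2 / (2 * beta') * S.
  have s0 : 0 < 2 * t * beta' by exact: mulr_gt0 (mulr_gt0 (ltr0Sn R 1) t0) beta'_gt0.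
  have := young ((tau + 2 * chi * rho) *: D.1) c PU (etrans (invr_gt0 _) s0).
  rewrite invrK !(ipZl PU, ipZr PU) -/dd mulrCA => h; apply: le_trans h _.
  have -> : (2 * t * beta')^-1 * ((tau + 2 * chi * rho) * ((tau + 2 * chi * rho) * dd))
     = ((tau + 2 * chi * rho) ^+ 2 / (2 * beta')) * (t^-1 * dd).
    by move: bn0; set b := beta' => bn0; field; rewrite bn0 gt_eqF.
  have -> : 2 * t * beta' = 2 * tau * beta + 2 * chi * rho * t * (1 + vartheta / kappa).
    by rewrite /t; move: kn0; set K := kappa => kn0; field.
  rewrite addrC lerD2l.
  apply: ler_wpM2l.
    by rewrite mulr_ge0 ?sqr_ge0// invr_ge0 mulr_ge0// ltW.
  by rewrite ler_pdivrMl.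
(* Bounds the right side of [precond_residual_le] by the two step lengths and [c]; the coefficient 3
   collects two contributions of [r'] and one of [r]. *)
have FY : precond D D - 2 * ipU D.1 (r' - r + c)
      + tau / kappa * ipU (r' - r + c) (r' - r + c)
   <= (1 + 3 * alpha + 2 * alpha ^+ 2 + 2 * tau * vartheta * t) * S
    + (alpha + 2 * alpha ^+ 2 + 2 * tau * vartheta * t) * S0
    + t * (1 + vartheta / kappa) * ipU c c - 2 * ipU D.1 c.
  have vt : 0 <= vartheta * t by rewrite mulr_ge0// ltW.
  have G1 : vartheta * (3 * dd + dd0) <= vartheta * (t * (3 * S + S0)).
    by apply: ler_wpM2l => //; lra.
  have G2 : t * (vartheta ^+ 2 * (2 * (dd + dd0)))
     <= t * (vartheta ^+ 2 * (2 * (t * (S + S0)))).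
    by rewrite ler_wpM2l ?(ltW t0)// ler_wpM2l ?sqr_ge0//; lra.
  have G3 : t * (2 * ipU (r' - r) c) <= 2 * tau * vartheta * (dd + dd0)
      + t * (vartheta / kappa) * ipU c c.
    have -> : 2 * tau * vartheta * (dd + dd0) + t * (vartheta / kappa) * ipU c c
      = t * (vartheta * (kappa * (2 * (dd + dd0)) + kappa^-1 * ipU c c)).
      by rewrite /t; move: kn0; set K := kappa => kn0; field.
    rewrite ler_wpM2l ?(ltW t0)//; apply: le_trans F5.
    by rewrite ler_wpM2l// ler_norm.
  have G4 : 2 * tau * vartheta * (dd + dd0) <= 2 * tau * vartheta * (t * (S + S0)).
    rewrite ler_wpM2l//; last by lra.
    by rewrite !mulr_ge0// ltW.
  have G5 : t * ipU (r' - r) (r' - r) <= t * (vartheta ^+ 2 * (2 * (dd + dd0))).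
    by rewrite ler_wpM2l ?(ltW t0).
  have -> : alpha = vartheta * t by rewrite /t; ring.
  have F3a := ler_norm (ipU r D.1).
  have -> : ipU D.1 (r' - r + c) = ipU r' D.1 - ipU r D.1 + ipU D.1 c.
    by rewrite !(ipDr PU, ipNr PU) !(ipC PU D.1).
  rewrite (ip_sqrD PU) -/S -/t.
  have F3c : - ipU r' D.1 <= `|ipU r' D.1| by rewrite -normrN ler_norm.
  have H : - 2 * (ipU r' D.1 - ipU r D.1) <= vartheta * (3 * dd + dd0) by lra.
  by lra.
(* This is where [eta] enters: relaxation leaves [1 - theta] times the product of the displacement
   with the new error, which [hmon] controls. *)
have G7 : 2 * tau * ((1 - theta) * ipU D.1 r') - 2 * tau * ipU D.1 r
   <= (2 * tau * eta - tau) * vartheta * (t * S) + tau * vartheta * (t * S0).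
  have h1 : 2 * tau * ((1 - theta) * ipU D.1 r') <=
      2 * tau * ((eta - 1) * vartheta * dd).
    by rewrite ler_pM2l// mulr_gt0.
  have h2 : tau * (2 * - ipU D.1 r) <= tau * (vartheta * (dd0 + dd)).
    rewrite ler_pM2l//; apply: le_trans F3; rewrite ler_pM2l//.
    by rewrite (ipC PU) -normrN ler_norm.
  have h3 : (2 * tau * eta - tau) * vartheta * dd
      <= (2 * tau * eta - tau) * vartheta * (t * S).
    rewrite ler_wpM2l// mulr_ge0//.
    have -> : 2 * tau * eta - tau = tau * (2 * eta - 1) by ring.
    by rewrite mulr_ge0 ?(ltW tau0)//; lra.
  have h4 : tau * vartheta * dd0 <= tau * vartheta * (t * S0).
    by rewrite ler_wpM2l// mulr_ge0// ltW.
  by lra.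
have G8 : 2 * tau * (beta * ipU c c) <= 2 * tau * ipU a.1 c.
  by rewrite ler_pM2l// mulr_gt0.
have k0 := k_ge0.
have chi0 : 0 <= chi by rewrite addr_ge0.
have nrho0 : 0 <= - 2 * rho by rewrite mulNr oppr_ge0 pmulr_rle0.
have tau2 : 0 <= 2 * tau by rewrite mulr_ge0// ltW.
have G9 := ler_wpM2l nrho0 (le_trans F2 (ler_wpM2l chi0 FY)).
have {}hsemi := ler_wpM2l tau2 hsemi.
set E1 := ipU (precond1 D - (r' - r + c)) _ in hsemi G9.
set E2 := ipV (precond2 D) (precond2 D) in hsemi G9.
have e : 2 * tau * (ipU (a.1 - D.1) (r' - r + c) + rho * (E1 + sigma / tau * E2) + N)
  = 2 * tau * ipU (a.1 - D.1) (r' - r + c) + 2 * rho * (tau * E1 + sigma * E2) + 2 * tau * N.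
  by field.
rewrite e in hsemi.
rewrite (ip_sqrB PM) !(ipZl PM, ipZr PM) (ipBl PU) (ipZl PU) -/S.
rewrite (ipBl PM) (ipBl PU) !(ipDr PU, ipNr PU) -/S in hsemi.
have -> : lyap_weight = tau * vartheta * t - 2 * chi * rho *
    ((1 + 2 * (vartheta * t)) * (vartheta * t) + 2 * tau * vartheta * t).
  by rewrite /lyap_weight /t; ring.
have -> : lyap_gap = tau * (2 - theta) - 2 * tau * eta * vartheta * t
   - (tau + 2 * chi * rho) ^+ 2 / (2 * beta')
   + 2 * chi * rho * ((2 * (vartheta * t) + 1) ^+ 2 + 4 * tau * vartheta * t).
  by rewrite /lyap_gap /t; ring.
have ae : alpha = vartheta * t by rewrite /t; ring.
rewrite {}ae in G9.
rewrite -subr_ge0.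
clear - theta0 G7 G8 G9 hsemi F6; clearbody S t E1 E2.
move: G7 G8 G9 hsemi F6.
move: ((tau + 2 * chi * rho) ^+ 2 / (2 * beta')) => q.
move: (kappa^-1) (k).
move: (precond a a) (precond a D) (ipU D.1 r') (ipU D.1 r) (ipU D.1 c)
  (ipU a.1 r') (ipU a.1 r) (ipU a.1 c) (ipU c c).
move=> Maa MaD x1 x2 x3 x4 x5 x6 x7 ik K G7 G8 G9 hsemi F6.
set T := (X in 0 <= X).
(* All terms share the factor [theta]; the cofactor is a sum of the slacks in the collected
   inequalities. *)
have -> : T = theta * (2 * tau * (MaD - S) + tau * (2 - theta) * S
   - 2 * tau * (x4 - theta * x1)
   - (tau * vartheta * t - 2 * (1 + K) * rho *
    ((1 + 2 * (vartheta * t)) * (vartheta * t) + 2 * tau * vartheta * t)) * S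
   + 2 * tau * x5 + (tau * vartheta * t - 2 * (1 + K) * rho *
    ((1 + 2 * (vartheta * t)) * (vartheta * t) + 2 * tau * vartheta * t)) * S0
   - (tau * (2 - theta) - 2 * tau * eta * vartheta * t
   - q + 2 * (1 + K) * rho * ((2 * (vartheta * t) + 1) ^+ 2 + 4 * tau * vartheta * t)) * S
   - 2 * tau * N) by rewrite /T; ring.
rewrite mulr_ge0 ?(ltW theta0)//.
by lra.
Qed.

Definition lyap (a : U * V) (r : U) (S : R) : R :=
  tau * precond a a + 2 * theta * tau * ipU a.1 r + theta * lyap_weight * S.

Context (eta1 : 1 <= eta) (gap_gt0 : 0 < lyap_gap).

Let chi_ge1 : 1 <= chi. Proof. by rewrite lerDl k_ge0. Qed.

Let alpha_ge0 : 0 <= alpha.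
Proof. by rewrite divr_ge0 ?mulr_ge0// ltW. Qed.

(** As [rho] is nonpositive, the second part of the weight can only increase it. The bound is what
    absorbs the cross term in [lyap_ge]. *)
Lemma lyap_weight_ge : tau * alpha <= lyap_weight.
Proof.
rewrite /lyap_weight lerDl -mulNr mulr_ge0//.
  by rewrite -mulrN mulr_ge0 ?oppr_ge0// mulr_ge0// (le_trans ler01).
apply: addr_ge0; first by rewrite mulr_ge0// addr_ge0// mulr_ge0.
by rewrite divr_ge0 ?(ltW kappa0)// !mulr_ge0 ?(ltW tau0).
Qed.

(** The subtracted part of the gap is nonnegative and [eta] is at least 1, so
    [2 - theta - 2 * alpha] is positive; multiply by [theta] and use that [theta * (2 - theta)]
    never exceeds 1. *)
Lemma theta_alpha_lt1 : theta * alpha < 1.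
Proof.
have q0 : 0 <= (tau + 2 * chi * rho) ^+ 2 / (2 * beta').
  by rewrite divr_ge0 ?sqr_ge0// mulr_ge0// ltW.
have s0 : 0 <= - (2 * chi * rho) * ((2 * tau * (vartheta / kappa) + 1) ^+ 2
                       + 4 * tau ^+ 2 * (vartheta / kappa)).
  apply: mulr_ge0.
    by rewrite -mulrN mulr_ge0 ?oppr_ge0// mulr_ge0// (le_trans ler01).
  by rewrite addr_ge0 ?sqr_ge0// mulr_ge0 ?divr_ge0 ?(ltW kappa0)// mulr_ge0 ?sqr_ge0.
have : 0 < tau * (2 - theta - 2 * tau * (eta * vartheta / kappa)).
  by move: gap_gt0 q0 s0; rewrite /lyap_gap; move: (_ / (2 * beta')) (tau * _) => *; lra.
rewrite pmulr_rgt0// => h.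
have e : tau * (eta * vartheta / kappa) = eta * alpha by ring.
have h1 : alpha <= eta * alpha by rewrite ler_peMl.
have h2 : 0 < 2 - theta - 2 * alpha by move: h; rewrite -mulrA e => h; lra.
have := mulr_gt0 theta0 h2; have := sqr_ge0 (theta - 1).
by move: alpha => A *; lra.
Qed.

(** * Two-sided comparison of the Lyapunov function with the metric *)

Section LyapBounds.
Context (a : U * V) (r : U) (dd S : R).
Context (hr : ipU r r <= vartheta ^+ 2 * dd) (hS : kappa * dd <= tau * S).

Let cross : 2 * `|ipU a.1 r| <= alpha * (S + precond a a).
Proof.
have := young_lipschitz a.1 PU vartheta0 hr ltr01; rewrite invr1 !mul1r (ipC PU r).
move=> h; apply: le_trans h _.
have -> : alpha * (S + precond a a) =
  vartheta * (kappa^-1 * (tau * S) + kappa^-1 * (tau * precond a a)) by ring.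
by rewrite ler_wpM2l// lerD// ler_pdivlMl// precond_ge_fst.
Qed.

Let cross_scaled : theta * tau * (2 * `|ipU a.1 r|) <=
  theta * tau * (alpha * (S + precond a a)).
Proof. by rewrite ler_pM2l// mulr_gt0. Qed.

Let S_ge0 : 0 <= dd -> 0 <= S.
Proof.
by move=> d0; rewrite -(pmulr_rge0 _ tau0); apply: le_trans hS; rewrite mulr_ge0// ltW.
Qed.

(** Young's inequality splits the cross term between the distance and the step length, and the
    weight pays for the latter. *)
Lemma lyap_ge : 0 <= dd -> tau * (1 - theta * alpha) * precond a a <= lyap a r S.
Proof.
move=> /S_ge0 S0.
have w : theta * (tau * alpha) * S <= theta * lyap_weight * S.
  by rewrite ler_wpM2r// ler_pM2l// lyap_weight_ge.
have h1 : theta * tau * (2 * - ipU a.1 r) <= theta * tau * (2 * `|ipU a.1 r|).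
  by rewrite ler_pM2l ?mulr_gt0// ler_pM2l// -normrN ler_norm.
have := cross_scaled; rewrite /lyap; move: w h1.
by move: (ipU a.1 r) (`|ipU a.1 r|) lyap_weight alpha (precond a a) => *; lra.
Qed.

Lemma lyap_le : lyap a r S <= tau * (1 + theta * alpha) * precond a a
  + theta * (lyap_weight + tau * alpha) * S.
Proof.
have h1 : theta * tau * (2 * ipU a.1 r) <= theta * tau * (2 * `|ipU a.1 r|).
  by rewrite ler_pM2l ?mulr_gt0// ler_pM2l// ler_norm.
have := cross_scaled; rewrite /lyap; move: h1.
by move: (ipU a.1 r) (`|ipU a.1 r|) lyap_weight alpha (precond a a) => *; lra.
Qed.

End LyapBounds.

Lemma prod_le_precond a :
  prod_ip ipU ipV a a <= (tau + sigma) / kappa * precond a a.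
Proof.
rewrite mulrAC ler_pdivlMr// /prod_ip.
have := precond_ge_fst a; have := precond_ge_snd a.
by move: kappa (precond a a) (ipU _ _) (ipV _ _) => *; lra.
Qed.

Lemma precond_le_prod a :
  precond a a <= (1 + k) * (tau^-1 + sigma^-1) * prod_ip ipU ipV a a.
Proof.
apply: le_trans (precond_le a) _; rewrite -mulrA ler_wpM2l ?(le_trans ler01)//.
have h1 : 0 <= tau^-1 * ipV a.2 a.2 by rewrite mulr_ge0 ?(ip_ge0 PV)// invr_ge0 ltW.
have h2 : 0 <= sigma^-1 * ipU a.1 a.1 by rewrite mulr_ge0 ?(ip_ge0 PU)// invr_ge0 ltW.
by move: h1 h2; rewrite /prod_ip; move: tau^-1 sigma^-1 (ipU _ _) (ipV _ _) => *; lra.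
Qed.

(** * Consequences of the decrease along a whole sequence *)

Section LyapSequence.
Context (Z D : nat -> U * V) (r : nat -> U) (a : U * V) (N : nat -> R).
Local Notation S n := (precond (D n) (D n)).
(** Each iterate is paired with the step leading to it, so the function starts at [Z 1] with
    [D 0]. *)
Local Notation W n := (lyap (Z n.+1 - a) (r n) (S n)).
Context (hr : forall n, ipU (r n) (r n) <= vartheta ^+ 2 * ipU (D n).1 (D n).1).
Context (N_ge0 : forall n, 0 <= N n).
Context (hW : forall n,
  W n.+1 <= W n - theta * lyap_gap * S n.+1 - 2 * theta * tau * N n).

Let PM := precond_semi_inner.
Let cst0 : 0 < tau * (1 - theta * alpha).
Proof. by rewrite mulr_gt0// subr_gt0 theta_alpha_lt1. Qed.

Let lyap_seq_ge n : tau * (1 - theta * alpha) * precond (Z n.+1 - a) (Z n.+1 - a) <= W n.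
Proof. exact: lyap_ge (hr n) (precond_ge_fst _) (ip_ge0 PU _). Qed.

Let W_ge0 n : 0 <= W n.
Proof. by apply: le_trans (lyap_seq_ge n); rewrite mulr_ge0 ?(ip_ge0 PM)// ltW. Qed.

Let W_decr n : W n.+1 <= W n - theta * lyap_gap * S n.+1.
Proof.
by apply: le_trans (hW n) _; rewrite gerBl mulr_ge0// !mulr_ge0// ltW.
Qed.

Lemma lyap_seq_step_cvg0 : (fun n => S n) @ \oo --> (0 : R).
Proof.
have [_ h] := decreasing_by_cvg0 (mulr_gt0 theta0 gap_gt0) W_ge0
  (fun n => ip_ge0 PM (D n.+1)) W_decr.
by rewrite -cvg_shiftS.
Qed.

Lemma lyap_seq_bounded n :
  precond (Z n.+1 - a) (Z n.+1 - a) <= W 0 / (tau * (1 - theta * alpha)).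
Proof.
rewrite ler_pdivlMr// mulrC; apply: le_trans (lyap_seq_ge n) _.
elim: n => // n IH; apply: le_trans IH; apply: le_trans (W_decr n) _.
by rewrite gerBl !mulr_ge0 ?(ip_ge0 PM)// ltW.
Qed.

(** The Lyapunov values converge, and both the step term and the cross term vanish, the latter
    because the distances stay bounded while [r n] tends to 0. *)
Lemma lyap_seq_dist_cvg : cvgn (fun n => precond (Z n.+1 - a) (Z n.+1 - a)).
Proof.
have [/cvg_ex[l Wl] _] := decreasing_by_cvg0 (mulr_gt0 theta0 gap_gt0) W_ge0
  (fun n => ip_ge0 PM (D n.+1)) W_decr.
have S0 := lyap_seq_step_cvg0.
pose B := (tau / kappa) * (W 0 / (tau * (1 - theta * alpha))).
have zB n : ipU (Z n.+1 - a).1 (Z n.+1 - a).1 <= B.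
  rewrite /B mulrAC ler_pdivlMr// mulrC.
  apply: le_trans (precond_ge_fst _) _.
  by rewrite ler_pM2l// lyap_seq_bounded.
have rB n : ipU (r n) (r n) <= vartheta ^+ 2 * (tau / kappa) * S n.
  apply: le_trans (hr n) _; rewrite -mulrA ler_wpM2l ?sqr_ge0//.
  by rewrite mulrAC ler_pdivlMr// mulrC precond_ge_fst.
have T0 : (fun n => ipU (Z n.+1 - a).1 (r n)) @ \oo --> (0 : R).
  apply/norm_cvg0P.
  apply: (@squeeze_cvgr _ _ _ _ (fun=> 0) (fun n =>
     Num.sqrt B * Num.sqrt (vartheta ^+ 2 * (tau / kappa) * S n))).
  - near=> n; rewrite normr_ge0/=; apply: le_trans (cauchy_schwarz_sqrt PU _ _) _.
    exact: ler_pM (sqrtr_ge0 _) (sqrtr_ge0 _) (ler_wsqrtr (zB n)) (ler_wsqrtr (rB n)).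
  - exact: cvg_cst.
  - rewrite -[0](mulr0 (Num.sqrt B)); apply: cvgMl_tmp; rewrite -sqrtr0.
    have h : (fun n => vartheta ^+ 2 * (tau / kappa) * S n) @ \oo --> (0 : R).
      by rewrite -[0](mulr0 (vartheta ^+ 2 * (tau / kappa))); apply: cvgMl_tmp.
    exact: (cvg_comp _ _ h (@sqrt_continuous R 0)).
have -> : (fun n => precond (Z n.+1 - a) (Z n.+1 - a)) = fun n =>
   tau^-1 * (W n - 2 * theta * tau * ipU (Z n.+1 - a).1 (r n)
     - theta * lyap_weight * S n).
  apply: funext => n; rewrite /lyap.
  have -> : forall x y z : R, x + y + z - y - z = x by move=> *; ring.
  by rewrite mulKf.
apply: is_cvgMl_tmp; apply: is_cvgB; first apply: is_cvgB.
- by apply/cvg_ex; exists l.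
- by apply: is_cvgMl_tmp; apply/cvg_ex; exists 0.
- by apply: is_cvgMl_tmp; apply/cvg_ex; exists 0.
Unshelve. all: by end_near. Qed.

(** Half of the gap is kept inside [E n], the other half and [N n] measure its decrease. Since [E n]
    is at most [K] times that decrease, it contracts by [1 - K^-1]. *)
Lemma lyap_seq_rate (nu : R) : 0 < nu ->
  (forall n, nu * prod_ip ipU ipV (Z n.+1 - D n.+1 - a) (Z n.+1 - D n.+1 - a) <= N n) ->
  exists C q : R, [/\ 0 <= C, 0 < q < 1 &
    forall n, prod_ip ipU ipV (Z n.+1 - a) (Z n.+1 - a) <= C * q ^+ n].
Proof.
move=> nu0 hN.
have PP := prod_semi_inner PU PV.
pose cp := (tau + sigma) / kappa.
pose cm := (1 + k) * (tau^-1 + sigma^-1).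
have cp0 : 0 <= cp by apply: divr_ge0 (ltW kappa0); rewrite addr_ge0// ltW.
have cm0 : 0 <= cm.
  by apply: mulr_ge0 (le_trans ler01 chi_ge1) _; rewrite addr_ge0// invr_ge0 ltW.
pose A := tau * (1 + theta * alpha).
have ta0 : 0 <= theta * alpha by rewrite mulr_ge0// ltW.
have A0 : 0 <= A by apply: mulr_ge0 (ltW tau0) (addr_ge0 ler01 ta0).
pose B := theta * (lyap_weight + tau * alpha).
have w0 : 0 <= lyap_weight.
  by apply: le_trans lyap_weight_ge; rewrite mulr_ge0// ltW.
have B0 : 0 <= B.
  by apply: mulr_ge0 (ltW theta0) (addr_ge0 w0 _); rewrite mulr_ge0// ltW.
pose g := theta * lyap_gap / 2.
have g0 : 0 < g by rewrite divr_gt0// mulr_gt0.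
pose h := 2 * theta * tau.
have h0 : 0 < h by rewrite !mulr_gt0.
(* Each of the first three summands pays for one part of the upper bound of [E n]; the final 1
   secures [K > 1], hence a positive ratio [q]. *)
pose K := (B + g) / g + 2 * A * cm * cp / g + 2 * A * cm / (nu * h) + 1.
pose E n := W n + g * S n.
have S0 n : 0 <= S n by exact: (ip_ge0 PM).
have EK n : E n <= K * (g * S n + g * S n.+1 + h * N n).
  (* The distance splits into the step and the distance from the resolvent point to [a]; the latter
     is what [N n] controls. *)
  have m1 : precond (Z n.+1 - a) (Z n.+1 - a) <= 2 * cm * (cp * S n.+1 + nu^-1 * N n).
    apply: le_trans (precond_le_prod _) _; rewrite -/cm (mulrC 2 cm) -[leRHS]mulrA ler_wpM2l//.
    have -> : Z n.+1 - a = D n.+1 + (Z n.+1 - D n.+1 - a).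
      by rewrite addrA addrCA subrr addr0.
    have := ip_ge0 PP (D n.+1 - (Z n.+1 - D n.+1 - a)).
    rewrite (ip_sqrB PP (D n.+1)) (ip_sqrD PP (D n.+1)) => i1.
    have i2 := prod_le_precond (D n.+1); rewrite -/cp in i2.
    have i3 : prod_ip ipU ipV (Z n.+1 - D n.+1 - a) (Z n.+1 - D n.+1 - a) <= nu^-1 * N n.
      by rewrite ler_pdivlMl.
    move: i1 i2 i3; rewrite mulrC.
    by move: (prod_ip _ _ _ _) (prod_ip _ _ _ _) (prod_ip _ _ _ _) => *; lra.
  have W1 := lyap_le (Z n.+1 - a) (hr n) (precond_ge_fst _).
  rewrite -/A -/B in W1.
  have A1 := ler_wpM2l A0 m1.
  (* The surplus nonnegative products in the expansion of [K] times the decrease. *)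
  pose rest := (B + g) * S n.+1 + (B + g) / g * h * N n + 2 * A * cm * cp * S n
      + 2 * A * cm * cp / g * h * N n
      + 2 * A * cm / (nu * h) * (g * S n + g * S n.+1)
      + (g * S n + g * S n.+1 + h * N n).
  have rest0 : 0 <= rest.
    rewrite /rest; move: (S0 n) (S0 n.+1) (N_ge0 n) (ltW g0) (ltW h0) (ltW nu0).
    move: (precond _ _) (precond _ _) (N n) => s s' N'.
    clearbody A B cp cm g h => *.
    by do ![exact: ler0n | assumption | apply: addr_ge0 | apply: divr_ge0 | apply: mulr_ge0].
  have -> : K * (g * S n + g * S n.+1 + h * N n) =
    B * S n + g * S n + A * (2 * cm * (cp * S n.+1 + nu^-1 * N n)) + rest.
    by rewrite /K /rest; clearbody A B cp cm g h; field; rewrite (gt_eqF g0) (gt_eqF h0) (gt_eqF nu0).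
  rewrite /E; move: rest0 A1 W1; clearbody rest.
  by move: (W n) (A * _) (A * _) (B * _) (g * _) => *; lra.
have K1 : 1 < K.
  rewrite /K ltrDr; clearbody A B cp cm g h; apply: ltr_pwDl.
    apply: ltr_pwDl; first by rewrite divr_gt0// ltr_wpDl.
    by apply: divr_ge0 (ltW g0); rewrite !mulr_ge0.
  by apply: divr_ge0; [rewrite !mulr_ge0|rewrite mulr_ge0// ltW].
have K0 : 0 < K by rewrite (lt_trans ltr01).
pose q := 1 - K^-1.
have q01 : 0 < q < 1.
  by rewrite subr_gt0 invf_lt1// K1 gtrBl invr_gt0.
have [q0 _] := andP q01.
have E_ge0 n : 0 <= E n by rewrite addr_ge0// mulr_ge0// ltW.
have Edecr n : E n.+1 <= q * E n.
  have e1 : K^-1 * E n <= g * S n + g * S n.+1 + h * N n by rewrite ler_pdivrMl.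
  have := hW n; rewrite -/h /q mulrBl mul1r.
  have -> : theta * lyap_gap * S n.+1 = 2 * (g * S n.+1) by rewrite /g; field.
  move: e1; rewrite /E; move: (W n.+1) (W n) (h * _) (g * _) (g * _) (K^-1 * _) => *.
  by lra.
have Epow n : E n <= q ^+ n * E 0.
  elim: n => [|n IH]; first by rewrite expr0 mul1r.
  apply: le_trans (Edecr n) _; rewrite exprS -mulrA ler_wpM2l// ltW//.
exists (cp * (E 0 / (tau * (1 - theta * alpha)))), q; split=> // [|n].
  by rewrite mulr_ge0// divr_ge0// ltW.
apply: le_trans (prod_le_precond _) _; rewrite -/cp -mulrA ler_wpM2l//.
rewrite mulrAC ler_pdivlMr// mulrC (mulrC (E 0)).
apply: le_trans (lyap_seq_ge n) _; apply: le_trans (Epow n).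
by rewrite /E lerDl mulr_ge0// ltW.
Qed.

End LyapSequence.

End Preconditioner.

(** * Hilbert spaces and the constant rho_hat *)

Lemma dot_semi_inner (R : realType) (V : lmodType R) (ip : {dot V for idfun}) :
  semi_inner ip.
Proof.
split=> [x y|a x y z|x].
- by rewrite hermC expr0 mul1r.
- by rewrite linearPl.
- have [->|x0] := eqVneq x 0; first by rewrite linear0l.
  exact/ltW/neq0_dnorm_gt0.
Qed.

Lemma dot_eq0 (R : realType) (V : lmodType R) (ip : {dot V for idfun}) x :
  ip x x = 0 -> x = 0.
Proof.
by move=> xx; apply/eqP/contraT => /(@neq0_dnorm_gt0 _ _ _ ip); rewrite xx ltxx.
Qed.

Lemma norm_cvg_of_ip (R : realType) (V : normedModType R) (ip : V -> V -> R)
    (u : nat -> V) (l : V) : norm_from_ip ip ->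
  (fun n => ip (u n - l) (u n - l)) @ \oo --> (0 : R) <-> u @ \oo --> l.
Proof.
move=> ipn; split=> [h|ul].
  apply/subr_cvg0/norm_cvg0P.
  have := cvg_comp _ _ h (@sqrt_continuous R 0); rewrite sqrtr0.
  suff -> : Num.sqrt \o (fun n => ip (u n - l) (u n - l)) = fun n => `|u n - l| by [].
  by apply: funext => n /=; rewrite -ipn sqrtr_sqr normr_id.
have h : (fun n => `|u n - l|) @ \oo --> (0 : R).
  by apply/norm_cvg0P/subr_cvg0.
have hh := cvgM h h; rewrite mul0r in hh.
under eq_fun do rewrite -ipn expr2.
exact: hh.
Qed.

Lemma norm_ip_complete (R : realType) (V : completeNormedModType R)
    (ip : V -> V -> R) : norm_from_ip ip -> ip_complete ip.
Proof.
move=> ipn u uC.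
have cv : cvgn u.
  apply/cauchy_cvgP/cauchy_exP => e e0.
  have [N hN] := uC (e ^+ 2) (exprn_gt0 2 e0).
  exists (u N); exists N => // n /= Nn; rewrite -ball_normE /=.
  by rewrite -(ltr_pXn2r (n := 2)) ?nnegrE ?(ltW e0)// ipn hN.
have /cvg_ex[l ul] := cv.
by exists l; apply/norm_cvg_of_ip.
Qed.

Lemma opnorm_ge0 (R : realType) (U V : normedModType R) (L : {linear U -> V}) :
  continuous L -> 0 <= opnorm L.
Proof.
move=> Lc.
(* Continuity bounds the set of values on the unit ball, without which [sup] would dominate
   nothing. *)
have := (linear_boundedP L).1 (continuous_linear_bounded 0 (Lc 0)).
move=> /pinfty_ex_gt0[r r0 hr].
rewrite /opnorm; apply: ub_le_sup; last by exists 0; rewrite /= ?linear0 normr0.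
exists r => _ [x /= x1 <-]; apply: le_trans (hr x) _.
by rewrite -[leRHS]mulr1 ler_pM2l.
Qed.

Lemma opnorm_bound (R : realType) (U V : normedModType R) (L : {linear U -> V}) x :
  continuous L -> `|L x| <= opnorm L * `|x|.
Proof.
move=> Lc; have [->|x0] := eqVneq x 0; first by rewrite linear0 !normr0 mulr0.
have := (linear_boundedP L).1 (continuous_linear_bounded 0 (Lc 0)).
move=> /pinfty_ex_gt0[r r0 hr].
have nx : 0 < `|x| by rewrite normr_gt0.
rewrite -ler_pdivrMr// /opnorm; apply: ub_le_sup.
  exists r => _ [y /= y1 <-]; apply: le_trans (hr y) _.
  by rewrite -[leRHS]mulr1 ler_pM2l.
exists (`|x|^-1 *: x) => /=.
  by rewrite normrZ ger0_norm ?invr_ge0// mulVf// gt_eqF.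
by rewrite linearZ/= normrZ ger0_norm ?invr_ge0// mulrC.
Qed.

(** After multiplication by [a + b] the difference of the sides is the squared norm of
    [a *: s - b *: t], whatever the signs of [a] and [b]. *)
Lemma parallel_sum_le (R : realType) (V : lmodType R) (ip : V -> V -> R) (a b : R) s t :
  semi_inner ip -> 0 < a + b ->
  parallel_sum a b * ip (s + t) (s + t) <= a * ip s s + b * ip t t.
Proof.
move=> P ab; have := ip_ge0 P (a *: s - b *: t).
rewrite /parallel_sum (ip_sqrB P) (ip_sqrD P) !(ipZl P, ipZr P) => h.
rewrite mulrAC ler_pdivrMr//; lra.
Qed.

(** * Merging quadratic terms through [rho_hat] *)

Section RhoHat.
Context (R : realType) (muA muB rhoA rhoB tau sigma : R).
Context (tau0 : 0 < tau) (sigma0 : 0 < sigma).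
Context (rho_ge0 : 0 <= rhoA + rhoB) (mu_ge0 : 0 <= muA + muB)
  (rho_eq0 : rhoA + rhoB = 0 -> rhoA = 0 /\ rhoB = 0)
  (mu_eq0 : muA + muB = 0 -> muA = 0 /\ muB = 0).
Local Notation rho := (rho_hat muA muB rhoA rhoB tau sigma).

(** These three bounds are all that is used later about the definition by cases. *)
Lemma rho_hat_bounds : [/\ rho <= 0,
  0 < rhoA + rhoB -> rho <= parallel_sum rhoA rhoB &
  0 < muA + muB -> rho <= tau / sigma * parallel_sum muA muB].
Proof.
rewrite /rho_hat lt_min.
have [r0|r0] := ltP 0 (rhoA + rhoB); have [m0|m0] := ltP 0 (muA + muB) => /=.
- by split=> [|_|_]; rewrite !ge_min lexx ?orbT.
- have [-> ->] := mu_eq0 (le_anti (introT andP (conj m0 mu_ge0))).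
  rewrite !andbF eqxx /=.
  by split=> [|_|//]; rewrite !ge_min lexx ?orbT.
- have [-> ->] := rho_eq0 (le_anti (introT andP (conj r0 rho_ge0))).
  rewrite eqxx /=.
  by split=> [|//|_]; rewrite !ge_min lexx ?orbT.
- by rewrite !andbF.
Qed.

Lemma rho_hat_le_rho (V : lmodType R) (ip : V -> V -> R) s t : semi_inner ip ->
  rho * ip (s + t) (s + t) <= rhoA * ip s s + rhoB * ip t t.
Proof.
move=> P; have [h0 h1 _] := rho_hat_bounds.
have [r0|r0] := ltP 0 (rhoA + rhoB).
  apply: le_trans (parallel_sum_le s t P r0).
  by rewrite ler_wpM2r ?(ip_ge0 P)// h1.
have [eA eB] := rho_eq0 (le_anti (introT andP (conj r0 rho_ge0))).
have -> : rhoA * ip s s + rhoB * ip t t = 0 by rewrite eA eB !mul0r addr0.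
by rewrite mulr_le0_ge0// (ip_ge0 P).
Qed.

(** The factor [sigma / tau] undoes the [tau / sigma] in front of the parallel sum; when the sum is
    zero both coefficients vanish and only the sign of [rho] matters. *)
Lemma rho_hat_le_mu (V : lmodType R) (ip : V -> V -> R) s t : semi_inner ip ->
  rho * (sigma / tau * ip (s + t) (s + t)) <= muA * ip s s + muB * ip t t.
Proof.
move=> P; have [h0 _ h1] := rho_hat_bounds.
have st : 0 < sigma / tau by rewrite divr_gt0.
have [r0|r0] := ltP 0 (muA + muB).
  apply: le_trans (parallel_sum_le s t P r0).
  rewrite mulrA ler_wpM2r ?(ip_ge0 P)//.
  by rewrite -ler_pdivlMr// invf_div mulrC h1.
have [eA eB] := mu_eq0 (le_anti (introT andP (conj r0 mu_ge0))).
have -> : muA * ip s s + muB * ip t t = 0 by rewrite eA eB !mul0r addr0.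
by rewrite mulr_le0_ge0// mulr_ge0 ?(ltW st)// (ip_ge0 P).
Qed.

End RhoHat.

(** * The primal-dual inequality and the convergence theorem *)

Section Adjoint.
Context (R : realType) (U V : lmodType R) (ipU : {dot U for idfun}) (ipV : V -> V -> R).
Context (PV : semi_inner ipV).
Context (L : {linear U -> V}) (Ls : V -> U) (adj : is_adjoint ipU ipV L Ls).

(** [Ls] is a bare function; the adjoint relation makes the defect of additivity orthogonal to
    everything, and definiteness kills it. *)
Lemma adjointD v w : Ls (v + w) = Ls v + Ls w.
Proof.
have PU := dot_semi_inner ipU.
apply/eqP; rewrite -subr_eq0; apply/eqP/(dot_eq0 (ip := ipU)).
by rewrite {2}opprD !(ipDr PU, ipNr PU) -!adj (ipDr PV) opprD addrACA !subrr addr0.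
Qed.

Lemma adjointB v w : Ls (v - w) = Ls v - Ls w.
Proof. by apply/eqP; rewrite eq_sym subr_eq -adjointD subrK. Qed.

End Adjoint.

Section PrimalDual.
Context (R : realType) (U V : lmodType R) (ipU : U -> U -> R) (ipV : V -> V -> R).
Context (PU : semi_inner ipU) (PV : semi_inner ipV).
Context (L : {linear U -> V}) (Ls : V -> U) (adj : is_adjoint ipU ipV L Ls).
Context (LsB : forall v w, Ls (v - w) = Ls v - Ls w).
Context (muA muB rhoA rhoB nuA nuB tau sigma : R).
Context (tau0 : 0 < tau) (sigma0 : 0 < sigma).
Context (rho_ge0 : 0 <= rhoA + rhoB) (mu_ge0 : 0 <= muA + muB)
  (rho_eq0 : rhoA + rhoB = 0 -> rhoA = 0 /\ rhoB = 0)
  (mu_eq0 : muA + muB = 0 -> muA = 0 /\ muB = 0).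
Local Notation rho := (rho_hat muA muB rhoA rhoB tau sigma).

(** Adding the two inequalities cancels the skew terms in [L]. The [rhoA] and [rhoB] terms merge
    into the primal residual, the [muA] and [muB] terms into the dual one. *)
Lemma semimonotone_primal_dual (p a xs cs : U) (q b us : V) :
  ipU (p - xs) (nuA *: (p - xs) + muA *: Ls (L (p - xs)))
    + ipU (a - (- cs - Ls us)) (rhoA *: (a - (- cs - Ls us)))
    <= ipU (p - xs) (a - (- cs - Ls us)) ->
  ipV (b - L xs) (muB *: (b - L xs))
    + ipV (q - us) (nuB *: (q - us) + rhoB *: L (Ls (q - us)))
    <= ipV (b - L xs) (q - us) ->
  nuA * ipU (p - xs) (p - xs) + nuB * ipV (q - us) (q - us)
   + rho * (ipU (a + Ls q + cs) (a + Ls q + cs)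
     + sigma / tau * ipV (b - L p) (b - L p))
  <= ipU (p - xs) (a + Ls q + cs) + ipV (q - us) (b - L p).
Proof.
have -> : a + Ls q + cs = (a - (- cs - Ls us)) + Ls (q - us).
  rewrite LsB opprD !opprK -!addrA; congr (_ + _).
  by rewrite (addrCA (Ls us)) subrr addr0 addrC.
have -> : b - L p = (b - L xs) + - L (p - xs).
  by rewrite linearB opprB addrA subrK.
set s := a - _; set y := b - L xs; set e := q - us; set x := p - xs.
clearbody s y e x => hA hB.
have h1 := rho_hat_le_rho tau sigma rho_ge0 mu_ge0 rho_eq0 mu_eq0 s (Ls e) PU.
have h2 := rho_hat_le_mu tau0 sigma0 rho_ge0 mu_ge0 rho_eq0 mu_eq0 (- L x) y PV.
rewrite (addrC (- L x)) !(ipNl PV, ipNr PV) opprK in h2.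
rewrite !(ipDr PU, ipZr PU) -adj in hA.
rewrite !(ipDr PV, ipZr PV) (ipC PV e (L _)) adj in hB.
have -> : ipU x (s + Ls e) = ipU x s + ipV (L x) e by rewrite (ipDr PU) adj.
have -> : ipV e (y + - L x) = ipV y e - ipV (L x) e.
  by rewrite (ipDr PV) (ipNr PV) !(ipC PV e).
have := lerD (lerD hA hB) (lerD h1 h2).
move: (ipU (s + _) _) (ipV (y - _) _) (rho) (sigma / tau) => X Y r' st.
by lra.
Qed.

End PrimalDual.

Lemma resolvent_mem (R : realType) (V : lmodType R) (E : V -> set V) (t : R) x p :
  0 < t -> resolvent (op_scale t E) x = [set p] -> E p (t^-1 *: (x - p)).
Proof.
move=> t0 h; have : resolvent (op_scale t E) x p by rewrite h.
case=> _ -> [_ [c Ec <-] <-]; rewrite addrC addKr scalerA mulVf ?gt_eqF//.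
by rewrite scale1r.
Qed.

Lemma cocoercive_lipschitz (R : realType) (V : normedModType R) (ip : V -> V -> R)
    (beta : R) (C : V -> V) x y : semi_inner ip -> norm_from_ip ip -> 0 < beta ->
  cocoercive ip beta C -> `|C x - C y| <= beta^-1 * `|x - y|.
Proof.
move=> P ipn b0 /(_ x y) h; rewrite ler_pdivlMl//.
have [->|n0] := eqVneq `|C x - C y| 0; first by rewrite mulr0.
have c0 : 0 < `|C x - C y| by rewrite lt_def n0 normr_ge0.
rewrite -(ler_pM2r c0) -mulrA -expr2; apply: le_trans h _.
apply: le_trans (ler_norm _) _; apply: le_trans (cauchy_schwarz_sqrt P _ _) _.
by rewrite -!ipn !sqrtr_sqr !normr_id.
Qed.

Lemma geometric_cvg0 (R : realType) (V : nat -> R) (c q : R) : 0 < q < 1 ->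
  (forall n, 0 <= V n <= c * q ^+ n) -> V @ \oo --> (0 : R).
Proof.
move=> /andP[q0 q1] h.
have g : (fun n => c * q ^+ n) @ \oo --> (0 : R).
  rewrite -[0](mulr0 c); apply: cvgMl_tmp; apply: cvg_expr.
  by rewrite ger0_norm// ltW.
by apply: squeeze_cvgr (cvg_cst 0) g; near=> n; exact: h.
Unshelve. all: by end_near. Qed.

Lemma rlinear_of_geometric (R : realType) (V : lmodType R) (ip : V -> V -> R)
    (u : nat -> V) (l : V) (c q : R) : 0 <= c -> 0 < q < 1 ->
  (forall n, ip (u n.+1 - l) (u n.+1 - l) <= c * q ^+ n) -> rlinear_cvg ip u l.
Proof.
move=> c0 /andP[q0 q1] h.
pose r := Num.sqrt q; have r0 : 0 < r by rewrite sqrtr_gt0.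
have cr : 0 <= Num.sqrt c / r by rewrite divr_ge0 ?sqrtr_ge0// ltW.
(* Dividing by [r] undoes the index shift in the hypothesis; the second summand covers [n = 0]. *)
exists (Num.sqrt c / r + Num.sqrt (ip (u 0%N - l) (u 0%N - l))), r; split.
- by rewrite addr_ge0 ?sqrtr_ge0.
- by rewrite r0 -[ltRHS]sqrtr1 ltr_sqrt.
- case=> [|n]; first by rewrite expr0 mulr1 lerDr.
  rewrite mulrDl exprS mulrA divfK ?gt_eqF//.
  apply: (@le_trans _ _ (Num.sqrt c * r ^+ n)).
    have cr0 : 0 <= Num.sqrt c * r ^+ n.
      by rewrite mulr_ge0 ?sqrtr_ge0// exprn_ge0// ltW.
    rewrite -(ger0_norm cr0) -sqrtr_sqr ler_wsqrtr//.
    by rewrite exprMn sqr_sqrtr// -exprM mulnC exprM sqr_sqrtr// ltW.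
  by rewrite lerDl mulr_ge0 ?sqrtr_ge0// mulr_ge0 ?exprn_ge0// ltW.
Qed.

(** Turns vector identities into scalar ones, which [ring] and [field] can settle. *)
Lemma dot_ext (R : realType) (V : lmodType R) (ip : {dot V for idfun}) x y :
  (forall w, ip x w = ip y w) -> x = y.
Proof.
move=> h; have P := dot_semi_inner ip.
apply/eqP; rewrite -subr_eq0; apply/eqP/(dot_eq0 (ip := ip)).
by rewrite {1}(ipBl P) h subrr.
Qed.

Lemma cvg0_of_ip_le (R : realType) (V : normedModType R) (ip : V -> V -> R)
    (u : nat -> V) (S : nat -> R) (c : R) : semi_inner ip -> norm_from_ip ip ->
  S @ \oo --> (0 : R) -> (forall n, ip (u n) (u n) <= c * S n) -> u @ \oo --> (0 : V).
Proof.
move=> P ipn S0 h; apply/(norm_cvg_of_ip _ _ ipn).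
have cS : (fun n => c * S n) @ \oo --> (0 : R).
  by rewrite -[0](mulr0 c); apply: cvgMl_tmp.
by apply: squeeze_cvgr (cvg_cst 0) cS; near=> n; rewrite subr0 (ip_ge0 P) h.
Unshelve. all: by end_near. Qed.

Unset Implicit Arguments.
Set Strict Implicit.

Theorem theorem4p10 (R : realType) (H G : completeNormedModType R)
  (ipH : {dot H for idfun}) (ipG : {dot G for idfun})
  (ipH_norm : norm_from_ip ipH) (ipG_norm : norm_from_ip ipG)
  (L : {linear H -> G}) (L_bounded : continuous L)
  (Ls : G -> H) (Ls_adjoint : is_adjoint ipH ipG L Ls)
  (A : H -> set H) (B : G -> set G) (C D : H -> H)
  (beta : R) (beta_gt0 : 0 < beta) (C_cocoercive : cocoercive ipH beta C)
  (vartheta : R) (vartheta_ge0 : 0 <= vartheta)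
  (D_lipschitz : vartheta.-lipschitz D)
  (Z : set (H * G)) (ZE : Z = sol_set L Ls A B C D) (Z_nonempty : Z !=set0)
  (muA muB rhoA rhoB nuA nuB : R) (nuA_ge0 : 0 <= nuA) (nuB_ge0 : 0 <= nuB)
  (rho_ge0 : 0 <= rhoA + rhoB) (mu_ge0 : 0 <= muA + muB)
  (rho_eq0 : rhoA + rhoB = 0 -> rhoA = 0 /\ rhoB = 0)
  (mu_eq0 : muA + muB = 0 -> muA = 0 /\ muB = 0)
  (AD_semimonotone :
    semimonotone ipH (fun x => nuA *: x + muA *: Ls (L x)) (fun u => rhoA *: u)
      [set (a.1, - C a.1 - Ls a.2) | a in Z] (op_add A (op_of D)))
  (B_semimonotone :
    semimonotone ipG (fun y => muB *: y) (fun v => nuB *: v + rhoB *: L (Ls v))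
      [set (L a.1, a.2) | a in Z] B)
  (OmegaA OmegaB : set R)
  (OmegaA_nonempty : OmegaA !=set0) (OmegaB_nonempty : OmegaB !=set0)
  (OmegaA_pos : OmegaA `<=` [set t | 0 < t])
  (OmegaB_pos : OmegaB `<=` [set s | 0 < s])
  (resolvents : forall t s, OmegaA t -> OmegaB s ->
    single_valued_full_domain (resolvent (op_scale t A)) /\
    single_valued_full_domain (resolvent (op_scale s (op_inv B))))
  (closed_gra : seq_weak_strong_closed (prod_ip ipH ipG)
    (gra (op_add (prod_opA L Ls A B D) (op_of (prod_opC (G := G) C)))))
  (tau sigma theta : R) (tau_in : OmegaA tau) (sigma_in : OmegaB sigma)
  (theta_in : 0 < theta < 2)
  (zm1 z0 p0 : H) (v0 : G)
  (z y x p : nat -> H) (v w q : nat -> G)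
  (z_init : z 0%N = z0) (p_init : p 0%N = p0) (v_init : v 0%N = v0)
  (y_step : forall n, y n = D (z n))
  (x_step : forall n, x n = z n -
    tau *: (y n - delay (D zm1) y n + D (p n) + C (z n) + Ls (v n)))
  (p_step : forall n, resolvent (op_scale tau A) (x n) = [set p n.+1])
  (w_step : forall n, w n = v n + sigma *: L (2 *: p n.+1 - z n))
  (q_step : forall n, resolvent (op_scale sigma (op_inv B)) (w n) = [set q n.+1])
  (zv_step : forall n, (z n.+1, v n.+1) =
    (1 - theta) *: (z n, v n) + theta *: (p n.+1, q n.+1)) :
  let kappa := 1 - sigma * tau * opnorm L ^+ 2 in
  let chi := 1 + Num.sqrt (sigma * tau) * opnorm L in
  let rho := rho_hat muA muB rhoA rhoB tau sigma in
  let eta := eta_theta ipH D theta in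
  0 < kappa ->
  0 < beta * kappa + chi * rho * (1 + vartheta / kappa) ->
  tau * (2 - theta - 2 * tau * (eta * vartheta / kappa)) >
    (tau + 2 * chi * rho) ^+ 2 /
      (2 * (beta * kappa + chi * rho * (1 + vartheta / kappa)))
    - 2 * chi * rho * ((2 * tau * (vartheta / kappa) + 1) ^+ 2
                       + 4 * tau ^+ 2 * (vartheta / kappa)) ->
  (exists2 a, Z a & weak_cvg (prod_ip ipH ipG) (fun n => (z n, v n)) a) /\
  (0 < nuA -> 0 < nuB ->
   exists2 a, Z = [set a] & rlinear_cvg (prod_ip ipH ipG) (fun n => (z n, v n)) a).
Proof.
move=> kappa chi rho eta kappa0 beta'0 gap.
have PH := dot_semi_inner ipH; have PG := dot_semi_inner ipG.
have PP := prod_semi_inner PH PG.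
have LsB := adjointB PG Ls_adjoint.
have tau0 : 0 < tau by exact: OmegaA_pos.
have sigma0 : 0 < sigma by exact: OmegaB_pos.
have /andP[theta0 theta2] := theta_in.
have m0 := opnorm_ge0 L_bounded.
have Lm a : ipG (L a) (L a) <= opnorm L ^+ 2 * ipH a a.
  rewrite -ipG_norm -ipH_norm -exprMn ler_sqr ?nnegrE ?mulr_ge0//.
  exact: opnorm_bound.
have [rho0 _ _] := rho_hat_bounds tau sigma rho_ge0 mu_ge0 rho_eq0 mu_eq0.
have eta1 : 1 <= eta by rewrite /eta /eta_theta; case: ifP => // _; rewrite lerDl.
have gap0 : 0 < lyap_gap (opnorm L) tau sigma theta vartheta beta rho eta.
  by rewrite subr_gt0.
pose zv n := (z n, v n).
pose del n := (z n - p n.+1, v n - q n.+1).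
pose r n := D (z n) - D (p n.+1).
pose M := precond ipH ipG L tau sigma.
have PM : semi_inner M := precond_semi_inner PH PG tau0 sigma0 Lm kappa0.
have zvS n : zv n.+1 = zv n - theta *: del n.
  rewrite /zv zv_step; congr (_, _) => /=.
    by apply: (dot_ext (ip := ipH)) => e; rewrite !(ipDl PH, ipNl PH, ipZl PH); ring.
  by apply: (dot_ext (ip := ipG)) => e; rewrite !(ipDl PG, ipNl PG, ipZl PG); ring.
have rB n : ipH (r n) (r n) <= vartheta ^+ 2 * ipH (del n).1 (del n).1.
  rewrite -!ipH_norm -exprMn ler_sqr ?nnegrE ?mulr_ge0//.
  exact: (D_lipschitz (z n, p n.+1)).
(* Graph points are taken from the second resolvent on: from there the reflection is
   [D (z n.+1) - r n], while the first step involves the arbitrary [zm1] and [p0]. *)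
pose a n := tau^-1 *: (x n.+1 - p n.+2) + D (p n.+2).
pose b n := sigma^-1 *: (w n.+1 - q n.+2).
have ADa n : op_add A (op_of D) (p n.+2) (a n).
  by exists (tau^-1 *: (x n.+1 - p n.+2)); [exact: resolvent_mem|exists (D (p n.+2))].
have Bb n : B (b n) (q n.+2) by exact: resolvent_mem sigma0 (q_step n.+1).
have aE n : a n + Ls (q n.+2)
    = precond1 Ls tau (del n.+1) - (r n.+1 - r n) - C (z n.+1).
  rewrite /a /precond1 /r x_step !y_step /= y_step LsB.
  apply: (dot_ext (ip := ipH)) => e; rewrite !(ipDl PH, ipNl PH, ipZl PH).
  by field; rewrite gt_eqF.
have bE n : b n - L (p n.+2) = precond2 L sigma (del n.+1).
  rewrite /b /precond2 w_step /= !linearB !linearZ /=.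
  apply: (dot_ext (ip := ipG)) => e; rewrite !(ipDl PG, ipNl PG, ipZl PG).
  by field; rewrite gt_eqF.
(* For monotone [D] and [theta >= 1] the left side is nonpositive; otherwise the Lipschitz bound
   costs [1 - theta] in absolute value. *)
have hmon n : (1 - theta) * ipH (del n).1 (r n)
    <= (eta - 1) * vartheta * ipH (del n).1 (del n).1.
  rewrite /eta /eta_theta; case: ifP => [/andP[/andP[t1 _] /asboolP mon]|_].
    rewrite subrr !mul0r mulr_le0_ge0 ?subr_le0//; exact: mon.
  have -> : 1 + `|1 - theta| - 1 = `|1 - theta| by ring.
  rewrite -mulrA; apply: le_trans (ler_norm _) _.
  rewrite normrM ler_wpM2l// (ipC PH).
  have := young_lipschitz (del n).1 PH vartheta_ge0 (rB n) ltr01.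
  by rewrite invr1 !mul1r; move: (ipH _ _) (`|_|) => *; lra.
pose N s n := nuA * ipH (p n.+2 - s.1) (p n.+2 - s.1)
  + nuB * ipG (q n.+2 - s.2) (q n.+2 - s.2).
have N_ge0 s n : 0 <= N s n.
  by rewrite addr_ge0// mulr_ge0// ?(ip_ge0 PH) ?(ip_ge0 PG).
have desc s : Z s -> forall n,
    lyap ipH ipG L (opnorm L) tau sigma theta vartheta rho (zv n.+2 - s) (r n.+1)
      (M (del n.+1) (del n.+1))
    <= lyap ipH ipG L (opnorm L) tau sigma theta vartheta rho (zv n.+1 - s) (r n)
      (M (del n) (del n))
      - theta * lyap_gap (opnorm L) tau sigma theta vartheta beta rho eta
        * M (del n.+1) (del n.+1)
      - 2 * theta * tau * N s n.
  move=> Zs n; rewrite zvS.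
  have -> : zv n.+1 - theta *: del n.+1 - s = (zv n.+1 - s) - theta *: del n.+1.
    by rewrite addrAC.
  pose c := C (z n.+1) - C s.1.
  apply: (descent_step PH PG Ls_adjoint m0 tau0 sigma0 Lm kappa0 theta0 vartheta_ge0
    rho0 beta'0 (c := c) (rB n) _ (rB n.+1) (hmon n.+1) eta1).
  - exact: precond_ge_fst.
  - rewrite -ipH_norm; exact: C_cocoercive.
  have hA := AD_semimonotone (p n.+2) (a n) s.1 (- C s.1 - Ls s.2)
    (ex_intro2 _ _ s Zs erefl) (ADa n).
  have hB := B_semimonotone (b n) (q n.+2) (L s.1) s.2
    (ex_intro2 _ _ s Zs erefl) (Bb n).
  have := semimonotone_primal_dual PH PG Ls_adjoint LsB tau0 sigma0
    rho_ge0 mu_ge0 rho_eq0 mu_eq0 hA hB.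
  rewrite aE bE (precondE PH PG Ls_adjoint).
  have cancel3 (V : zmodType) (e f g : V) : e - f - (e - g) = g - f.
    by rewrite addrAC opprB addrCA subrr addr0.
  have -> : precond1 Ls tau (del n.+1) - (r n.+1 - r n) - C (z n.+1) + C s.1
      = precond1 Ls tau (del n.+1) - (r n.+1 - r n + c).
    by apply: (dot_ext (ip := ipH)) => e; rewrite !(ipDl PH, ipNl PH); ring.
  rewrite (_ : (zv n.+1 - s).1 - (del n.+1).1 = p n.+2 - s.1); last exact: cancel3.
  rewrite (_ : zv n.+1 - s - del n.+1 = (p n.+2 - s.1, q n.+2 - s.2)); last first.
    by congr (_, _); exact: cancel3.
  rewrite /prod_ip /N /= (ipBr PH _ _ (p n.+2 - s.1)) -/rho.
  by move: (ipH (precond1 _ _ _ - _) _) (sigma / tau) => X Y; lra.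
have [s0 Zs0] := Z_nonempty.
have S0 : (fun n => M (del n) (del n)) @ \oo --> (0 : R).
  exact (lyap_seq_step_cvg0 PH PG m0 tau0 sigma0 Lm kappa0 theta0 vartheta_ge0
    rho0 beta'0 eta1 gap0 rB (N_ge0 s0) (desc s0 Zs0)).
pose cp := (tau + sigma) / kappa.
have cp0 : 0 <= cp by apply: divr_ge0 (ltW kappa0); rewrite addr_ge0// ltW.
have prodM e : prod_ip ipH ipG e e <= cp * M e e.
  exact (prod_le_precond PH PG Ls_adjoint m0 tau0 sigma0 Lm kappa0 e).
have prod_eq0 e : prod_ip ipH ipG e e = 0 -> e = 0.
  move=> /eqP; rewrite paddr_eq0 ?(ip_ge0 PH) ?(ip_ge0 PG)//.
  case: e => e1 e2 /= /andP[/eqP h1 /eqP h2].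
  by rewrite (dot_eq0 h1) (dot_eq0 h2).
have compl : ip_complete (prod_ip ipH ipG).
  exact: prod_ip_complete PH PG (norm_ip_complete ipH_norm) (norm_ip_complete ipG_norm).
split.
  have del0 : weak_cvg (prod_ip ipH ipG) del 0.
    apply: (weak_of_strong PP).
    have h : (fun n => cp * M (del n) (del n)) @ \oo --> (0 : R).
      by rewrite -[0](mulr0 cp); apply: cvgMl_tmp.
    by apply: squeeze_cvgr (cvg_cst 0) h; near=> n; rewrite subr0 (ip_ge0 PP) prodM.
  have d1 n : ipH (del n).1 (del n).1 <= cp * M (del n) (del n).
    by apply: le_trans (prodM _); rewrite lerDl (ip_ge0 PG).
  have r0 : r @ \oo --> (0 : H).
    apply: (cvg0_of_ip_le (c := vartheta ^+ 2 * cp) PH ipH_norm S0) => n.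
    apply: le_trans (rB n) _; rewrite -(mulrA _ cp); apply: ler_wpM2l; [exact: sqr_ge0|exact: d1].
  have Cd0 : (fun n => C (p n.+1) - C (z n)) @ \oo --> (0 : H).
    apply: (cvg0_of_ip_le (c := beta^-1 ^+ 2 * cp) PH ipH_norm S0) => n.
    rewrite -ipH_norm; apply: (@le_trans _ _ (beta^-1 ^+ 2 * `|(del n).1| ^+ 2)).
      rewrite -exprMn ler_sqr ?nnegrE ?mulr_ge0 ?invr_ge0 ?(ltW beta_gt0)//.
      by rewrite (distrC (z n)); exact: cocoercive_lipschitz PH ipH_norm beta_gt0 _.
    rewrite ipH_norm -(mulrA _ cp); apply: ler_wpM2l; [exact: sqr_ge0|exact: d1].
  (* With [h = 0] the estimate bounds both components of the preconditioned step by its metric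
     length. *)
  have res n := precond_residual_le PH PG Ls_adjoint m0 tau0 sigma0 Lm kappa0 (del n) 0.
  have pc1 : (fun n => precond1 Ls tau (del n)) @ \oo --> (0 : H).
    apply: (cvg0_of_ip_le (c := tau^-1 * chi) PH ipH_norm S0) => n.
    have := res n; rewrite subr0 !(ip0r PH) !mulr0 subr0 addr0 => h.
    rewrite -mulrA ler_pdivlMl//; apply: le_trans h.
    by rewrite lerDl mulr_ge0 ?(ltW sigma0)// (ip_ge0 PG).
  have pc2 : (fun n => precond2 L sigma (del n)) @ \oo --> (0 : G).
    apply: (cvg0_of_ip_le (c := sigma^-1 * chi) PG ipG_norm S0) => n.
    have := res n; rewrite subr0 !(ip0r PH) !mulr0 subr0 addr0 => h.
    rewrite -mulrA ler_pdivlMl//; apply: le_trans h.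
    by rewrite lerDr mulr_ge0 ?(ltW tau0)// (ip_ge0 PH).
  (* The graph needs [C] at the resolvent point whereas the iteration evaluates it at [z]; the
     discrepancy is [Cd0]. *)
  have res1 : (fun n => a n + Ls (q n.+2) + C (p n.+2)) @ \oo --> (0 : H).
    have -> : (fun n => a n + Ls (q n.+2) + C (p n.+2)) = fun n =>
      precond1 Ls tau (del n.+1) - (r n.+1 - r n) + (C (p n.+2) - C (z n.+1)).
      by apply: funext => n; rewrite aE -addrA (addrC (- C _)).
    rewrite -[0](addr0 0) -{1}(subr0 0) -{2}(subrr 0).
    apply: cvgD; first apply: cvgB; first exact: (cvg_reindex (fun k => leqnSn k) pc1).
      by apply: cvgB => //; exact: (cvg_reindex (fun k => leqnSn k) r0).
    exact: (cvg_reindex (fun k => leqnSn k) Cd0).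
  have res2 : (fun n => b n - L (p n.+2) + 0) @ \oo --> (0 : G).
    under eq_fun do rewrite addr0 bE.
    exact (cvg_reindex (fun k => leqnSn k) pc2).
  have [l Zl wl] : exists2 l, Z l & weak_cvg (prod_ip ipH ipG) (fun n => zv n.+1) l.
    (* A squared norm is at most twice the squared distance to [s0], bounded by the initial Lyapunov
       value, plus twice that of [s0]. *)
    pose K := 2 * (cp * (lyap ipH ipG L (opnorm L) tau sigma theta vartheta rho
      (zv 1 - s0) (r 0) (M (del 0) (del 0)) / (tau * (1 - theta *
        (tau * vartheta / kappa))))) + 2 * prod_ip ipH ipG s0 s0.
    apply: (opial (M := M) (K := K) PP compl _ PM).
    - move=> n; have -> : zv n.+1 = (zv n.+1 - s0) + s0 by rewrite subrK.
      have := ip_ge0 PP ((zv n.+1 - s0) - s0).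
      rewrite (ip_sqrB PP (zv n.+1 - s0)) (ip_sqrD PP (zv n.+1 - s0)).
      have := lyap_seq_bounded PH PG m0 tau0 sigma0 Lm kappa0 theta0 vartheta_ge0
        rho0 beta'0 eta1 gap0 rB (N_ge0 s0) (desc s0 Zs0) n.
      move=> /(ler_wpM2l cp0) h1; have h2 := prodM (zv n.+1 - s0).
      have := le_trans h2 h1; rewrite /K.
      move: (prod_ip _ _ _ _) (prod_ip _ _ _ _) (prod_ip _ _ _ _) => *; lra.
    - by move=> e e0; apply: prod_eq0; apply/eqP;
        rewrite eq_le (ip_ge0 PP) andbT (le_trans (prodM e))// e0 mulr0.
    - move=> e; exists (precond1 Ls tau e, precond2 L sigma e) => f.
      by rewrite /M (precondE PH PG Ls_adjoint).
    - move=> s Zs.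
      exact (lyap_seq_dist_cvg PH PG m0 tau0 sigma0 Lm kappa0 theta0 vartheta_ge0
        rho0 beta'0 eta1 gap0 rB (N_ge0 s) (desc s Zs)).
    - move=> f l fk wf.
      (* The resolvent points have the same weak cluster points as the iterates, the steps being
         null in the limit, and their residuals tend strongly to 0. *)
      have := closed_gra (fun k => (p (f k).+2, q (f k).+2))
        (fun k => (a (f k) + Ls (q (f k).+2) + C (p (f k).+2), b (f k) - L (p (f k).+2) + 0))
        l 0.
      case.
      + move=> e.
        have -> : (fun k => prod_ip ipH ipG (p (f k).+2, q (f k).+2) e) = fun k =>
            prod_ip ipH ipG (zv (f k).+1) e - prod_ip ipH ipG (del (f k).+1) e.
          apply: funext => k; rewrite -(ipBl PP); congr (prod_ip _ _ (_, _) e).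
            by rewrite /= opprB addrC subrK.
          by rewrite /= opprB addrC subrK.
        rewrite -[prod_ip _ _ l e]subr0 -(ip0l PP e).
        apply: cvgB; first exact: wf.
        exact (cvg_reindex (fun k => leqW (fk k)) (del0 e)).
      + apply: cvg_pair; first exact (cvg_reindex fk res1).
        exact (cvg_reindex fk res2).
      + move=> k; exists (a (f k) + Ls (q (f k).+2), b (f k) - L (p (f k).+2)).
          split; first by exists (a (f k)) => //; exact: ADa.
          by exists (b (f k)) => //; exact: Bb.
        by exists (C (p (f k).+2), 0).
      + move=> [e1 e2] [[e /= [f1 Af1 [f2 -> <-]] <-] [g /= Bg <-]] [_ -> [h1 h2]].
        rewrite ZE; split.
          exists (f1 + C l.1 + D l.1).
            by exists (f1 + C l.1); [exists f1 => //; exists (C l.1)|exists (D l.1)].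
          rewrite /= (addrAC f1) [LHS]addrAC. exact h1.
        by move/eqP: h2; rewrite addr0 subr_eq0 => /eqP <-.
  exists l => // e; have := wl e.
  by rewrite (cvg_shiftS (fun n => prod_ip ipH ipG (zv n) e)).
move=> nuA0 nuB0.
have nu0 : 0 < Num.min nuA nuB by rewrite lt_min nuA0.
have rate s (Zs : Z s) := lyap_seq_rate PH PG Ls_adjoint m0 tau0 sigma0 Lm kappa0
  theta0 vartheta_ge0 rho0 beta'0 eta1 gap0 rB (N_ge0 s) (desc s Zs) nu0.
have {}rate s : Z s -> exists c k : R, [/\ 0 <= c, 0 < k < 1 &
    forall n, prod_ip ipH ipG (zv n.+1 - s) (zv n.+1 - s) <= c * k ^+ n].
  move=> /rate; apply=> n.
  have -> : zv n.+1 - del n.+1 - s = (p n.+2 - s.1, q n.+2 - s.2).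
    by congr (_, _); rewrite /= opprB addrCA subrr addr0.
  rewrite /prod_ip /N mulrDr lerD//.
    by rewrite ler_wpM2r ?(ip_ge0 PH)// ge_min lexx.
  by rewrite ler_wpM2r ?(ip_ge0 PG)// ge_min lexx orbT.
exists s0; last first.
  have [c [k [c0 k01 h]]] := rate s0 Zs0.
  exact: rlinear_of_geometric c0 k01 h.
(* Uniqueness: the same sequence converges to every solution, and limits are unique. *)
apply/seteqP; split=> [s Zs|_ ->//].
have weak e : Z e -> weak_cvg (prod_ip ipH ipG) (fun n => zv n.+1) e.
  move=> /rate[c [k [c0 k01 h]]]; apply: (weak_of_strong PP).
  exact (geometric_cvg0 k01 (fun n => introT andP (conj (ip_ge0 PP _) (h n)))).
apply/eqP; rewrite -subr_eq0; apply/eqP/prod_eq0; rewrite {1}(ipBl PP).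
by rewrite (cvg_unique (@Rhausdorff R) (weak s Zs _) (weak s0 Zs0 _)) subrr.
Unshelve. all: by end_near. Qed.
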